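(* Let $\Omega\subset\mathbb{R}$ be a bounded open interval, $b\in\mathbb{R}\setminus\{0\}$ constant, $f\in L_2(\Omega)$, and $\mathcal{T}_h$ a mesh of $\Omega$. Let $u\in L_2(\Omega)$ be the solution of $-(u,b\nabla v)=(f,v)$ for all $v\in H^1_+(\Omega)$, and let $u_h\in\mathcal{P}^k(\mathcal{T}_h)$, $k\ge 0$, be its approximation, satisfying $$(f,\psi_a)_{\omega_a}+(u_h,b\nabla\psi_a)_{\omega_a}=0\qquad\forall\,a\in\mathcal{V}_h^{\mathrm{int}}\cup\mathcal{V}_h^{\partial_-\Omega}.$$ Let $k'\ge k$ and let $s_h=\sum_{a\in\mathcal{V}_h}\psi_a s_h^a$, where for each $a\in\mathcal{V}_h$, $s_h^a\in\mathcal{P}^{k'}(\mathcal{T}_a)\cap H^1(\omega_a)$ is the solution of $$(b\nabla(\psi_a s_h^a),v_h)_{\omega_a}=(f\psi_a+(b\nabla\psi_a)u_h,\,v_h)_{\omega_a}\qquad\forall\,v_h\in\mathcal{P}^{k'}(\mathcal{T}_a).$$ Let $\eta_{\mathrm{NC},K}=\|u_h-s_h\|_K$. Then, for all $K\in\mathcal{T}_h$, $$\eta_{\mathrm{NC},K}\le C_{\mathrm{cont,PF}}\sum_{a\in\mathcal{V}_K}\|u-u_h\|_{\omega_a}+\sum_{a\in\mathcal{V}_K}\frac{h_{\omega_a}}{\pi|b|}\,\bigl\|(I-\Pi_{\mathcal{P}^{k'}(\mathcal{T}_a)})(f\psi_a)\bigr\|_{\omega_a}.$$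
   Context: Notation: $(v,w)_D=\int_D vw$, $\|v\|_D=(v,v)_D^{1/2}$, with the subscript dropped when $D=\Omega$; $\nabla v=v'$. For an open interval $D$ with outward unit normal $n=\pm1$ at its endpoints, $\partial_\pm D=\{x\in\partial D:\pm b\,n(x)>0\}$ ($-$ inflow, $+$ outflow) and $H^1_\pm(D)=\{w\in H^1(D): w=0\text{ on }\partial_\pm D\}$. Mesh: $\mathcal{T}_h$ is a finite division of $\Omega$ into non-overlapping intervals covering $\Omega$, shape regular in the sense that any two neighboring intervals have comparable lengths up to a constant $\kappa_{\mathcal{T}_h}$. The set of vertices is $\mathcal{V}_h=\mathcal{V}_h^{\mathrm{int}}\cup\mathcal{V}_h^{\partial_-\Omega}\cup\mathcal{V}_h^{\partial_+\Omega}$ (interior, inflow and outflow vertices); $\mathcal{V}_K$ is the set of vertices of $K$. For $a\in\mathcal{V}_h$, $\mathcal{T}_a$ is the set of elements having $a$ as a vertex, $\omega_a$ the corresponding open interval, $h_{\omega_a}$ its diameter, and $\psi_a$ the continuous piecewise affine hat function equal to $1$ at $a$ and $0$ at all other vertices. $\mathcal{P}^{m}(\mathcal{T})$ denotes piecewise polynomials of degree at most $m$ on $\mathcal{T}$ (no continuity imposed), and $\Pi_{\mathcal{P}^{k'}(\mathcal{T}_a)}$ is the $L_2(\omega_a)$-orthogonal projection onto $\mathcal{P}^{k'}(\mathcal{T}_a)$. The local solutions $s_h^a$ exist and are unique; products $\psi_a s_h^a$ are extended by zero outside $\omega_a$. Constant: let $H^1_*(\omega_a)=\{v\in H^1(\omega_a):(v,1)_{\omega_a}=0\}$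 if $a\notin\mathcal{V}_h^{\partial_+\Omega}$ and $H^1_*(\omega_a)=H^1_+(\omega_a)$ if $a\in\mathcal{V}_h^{\partial_+\Omega}$. $C_{\mathrm{PF},\omega_a}>0$ is a constant in the Poincaré(–Friedrichs) inequality $\|v\|_{\omega_a}\le h_{\omega_a}C_{\mathrm{PF},\omega_a}\|\nabla v\|_{\omega_a}$ for all $v\in H^1_*(\omega_a)$ (for an interval it can be taken equal to $1$), and $$C_{\mathrm{cont,PF}}=\max_{a\in\mathcal{V}_h}\bigl(1+C_{\mathrm{PF},\omega_a}h_{\omega_a}\|\nabla\psi_a\|_\infty\bigr),$$ which only depends on the shape regularity of the mesh. *)

(* Defs.v *)
From HB Require Import structures.
From mathcomp Require Import all_boot all_order all_algebra.
From mathcomp Require Import all_classical all_reals all_analysis.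

Set Implicit Arguments.
Unset Strict Implicit.
Unset Printing Implicit Defensive.

Import Order.TTheory GRing.Theory Num.Theory.
Import numFieldNormedType.Exports.

Local Open Scope classical_set_scope.
Local Open Scope ring_scope.

(* Elements of L2(D) and H1(D) are represented by total functions
   [R -> R]; only their values almost everywhere on [D] matter. *)
Section function_spaces.
Context {R : realType}.
Implicit Types (D : set R) (v w g phi : R -> R) (b c d e : R).
Local Notation mu := (@lebesgue_measure R).

Definition L2 D v : Prop := v \_ D \in Lfun mu 2%:E.

Definition ip D v w : R := \int[mu]_(x in D) (v x * w x).

Definition nrm D v : R := Num.sqrt (ip D v v).

Definition nrm_oo D v : R := fine ('N[mu]_+oo [EFin \o (v \_ D)])%E.

Definition C1c D phi : Prop :=
  [/\ forall x, derivable phi x 1,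
      continuous (derive1 phi),
      compact (closure [set x | phi x != 0]) &
      closure [set x | phi x != 0] `<=` D].

(* Weak derivatives are tested against C^1 functions with compact support;
   by density this is the same as testing against C^oo ones. *)
Definition weak_derivative D v g : Prop :=
  L2 D g /\ forall phi, C1c D phi -> ip D v (derive1 phi) = - ip D g phi.

Definition H1 D v : Prop := L2 D v /\ exists g, weak_derivative D v g.

(* A representative of the weak derivative, unique up to null subsets of [D];
   the zero function if there is no weak derivative in L2(D). *)
Definition grad D v : R -> R := xget (cst 0) [set g | weak_derivative D v g].

(* The trace at the endpoint [e] of [c, d] is the value at [e] of the
   representative that is continuous on [c, d]. *)
Definition vanishes_at c d v e : Prop :=
  exists w, [/\ {within `[c, d], continuous w},
                {ae mu, forall x, x \in `]c, d[ -> v x = w x} & w e = 0].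

(* Only meaningful when [e] is one of the endpoints of ]c, d[. *)
Definition normal c e : R := if e == c then -1 else 1.

Definition outflow b c d : set R :=
  [set e | (e = c \/ e = d) /\ 0 < b * normal c e].

Definition inflow b c d : set R :=
  [set e | (e = c \/ e = d) /\ 0 < - (b * normal c e)].

Definition H1_plus b c d v : Prop :=
  H1 `]c, d[ v /\ forall e, outflow b c d e -> vanishes_at c d v e.

(* Unique up to null subsets of [D] when [S] is a subspace of L2(D). *)
Definition L2proj D (S : set (R -> R)) g : R -> R :=
  xget (cst 0) [set p | S p /\ forall q, S q -> ip D (g \- p) q = 0].

End function_spaces.

(* The vertices are [node 0 < ... < node ncell]; the values of [node] beyond
   [ncell] are irrelevant. *)
Record mesh (R : realType) (l r : R) := Mesh {
  ncell : nat;
  node : nat -> R;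
  kappa : R;
  ncell_gt0 : (0 < ncell)%N;
  node_first : node 0%N = l;
  node_last : node ncell = r;
  node_lt : forall i, (i < ncell)%N -> node i < node i.+1;
  shape_regular : forall i, (i.+1 < ncell)%N ->
    node i.+1 - node i <= kappa * (node i.+2 - node i.+1) /\
    node i.+2 - node i.+1 <= kappa * (node i.+1 - node i) }.

Section mesh_theory.
Context {R : realType} {l r : R} (M : mesh l r).

Definition vertex := 'I_(ncell M).+1.
Definition element := 'I_(ncell M).
Implicit Types (a : vertex) (K : element).

Definition cell K : set R := `]node M K, node M K.+1[.

Definition is_vertex_of a K : bool := (a == K :> nat) || (a == K.+1 :> nat).

(* Endpoints of omega_a: the neighbours of vertex [a], or [a] itself where
   there is none. *)
Definition omega_l a : R := node M a.-1.
Definition omega_r a : R := node M (minn a.+1 (ncell M)).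
Definition omega a : set R := `]omega_l a, omega_r a[.
Definition h_omega a : R := omega_r a - omega_l a.

Definition hat a (x : R) : R :=
  let y := node M a in
  if x == y then 1
  else if omega_l a < x < y then (x - omega_l a) / (y - omega_l a)
  else if y < x < omega_r a then (omega_r a - x) / (omega_r a - y)
  else 0.

(* Piecewise polynomials of degree at most [m] on the elements in [T]; recall
   that [size p] is the degree plus one. *)
Definition ppoly (m : nat) (T : pred element) : set (R -> R) :=
  [set v | forall K, T K ->
    exists2 p : {poly R}, (size p <= m.+1)%N & forall x, cell K x -> v x = p.[x]].

Definition interior_vertex a : Prop := node M a \in `]l, r[.
Definition inflow_vertex b a : Prop := inflow b l r (node M a).
Definition outflow_vertex b a : Prop := outflow b l r (node M a).

Definition H1_star b a (v : R -> R) : Prop :=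
  (~ outflow_vertex b a -> H1 (omega a) v /\ ip (omega a) v (cst 1) = 0) /\
  (outflow_vertex b a -> H1_plus b (omega_l a) (omega_r a) v).

Definition is_PF_constant b a (C : R) : Prop :=
  0 < C /\ forall v, H1_star b a v ->
    nrm (omega a) v <= h_omega a * C * nrm (omega a) (grad (omega a) v).

(* The terms are at least 1, so the default value 0 of the maximum is harmless. *)
Definition C_cont_PF (C_PF : vertex -> R) : R :=
  \big[Num.max/0]_(a : vertex)
    (1 + C_PF a * h_omega a * nrm_oo (omega a) (grad (omega a) (hat a))).

End mesh_theory.

(* Main.v *)
Require Import Defs.
From HB Require Import structures.
From mathcomp Require Import all_boot all_order all_algebra.
From mathcomp Require Import all_classical all_reals all_analysis.
From mathcomp Require Import measurable_realfun ess_sup_inf ring lra.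

Set Implicit Arguments.
Unset Strict Implicit.
Unset Printing Implicit Defensive.

Import Order.TTheory GRing.Theory Num.Theory.
Import numFieldNormedType.Exports.

Local Open Scope classical_set_scope.
Local Open Scope ring_scope.

(** Write [z] for [hat a * (uh - s a)]. On an element the hat functions of its
    two endpoints sum to 1, so the error [uh - sh] is the sum of the two [z],
    and it suffices to bound each [z] on its patch, by
    [weighted_error_bound].

    Take [v] with [v' = z], of mean zero on the patch, or zero at the vertex if
    that is the outflow one; then [|z|^2 = (z, v')]. The product [hat * v] is a
    test function for the equation of [u], and the discrete equation for
    [s a], in which the test space has the degree of the trial space, says that
    [b (hat * s a)'] is [b hat' uh] plus the projection of [f * hat].
    Combining them, [b |z|^2] equals
    [b (hat (uh - u), z) + b (hat' (uh - u), v) - (g, v)] with [g] the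
    projection error of [f * hat]. The Poincare-Friedrichs constant bounds [v]
    in the second term. In the third, [g] is orthogonal to constants, and
    integrating it once more turns the bound into the inequality
    [|G| <= h / pi |G'|] for functions vanishing at both ends
    ([friedrichs_sharp]).

    Several facts about weak derivatives carry the argument: they are unique
    up to null sets ([weak_unique]), so that [grad] can be computed; a function
    that has one is a.e. equal to a primitive of it ([weak_abscont], by the
    lemma of du Bois-Reymond); and primitives can be multiplied
    ([abscont_mul], by Fubini's theorem). With [abscont] functions the boundary
    terms are honest point values. They vanish at an inflow vertex because the
    balance equation for [uh] forces [s a] to vanish there. *)

(** * Integrable and square-integrable functions *)
Definition L1 {R : realType} (D : set R) (v : R -> R) : Prop :=
  (@lebesgue_measure R).-integrable D (EFin \o v).

Section L1_theory.
Context {R : realType}.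
Implicit Types (D : set R) (f g v w : R -> R).
Local Notation mu := (@lebesgue_measure R).

Lemma L1_meas D v : measurable D -> L1 D v -> measurable_fun D v.
Proof. by move=> mD /integrableP[/measurable_EFinP]. Qed.

Lemma le_L1 D v w : measurable D -> measurable_fun D v ->
  (forall x, D x -> `|v x| <= `|w x|) -> L1 D w -> L1 D v.
Proof.
move=> mD mv vw iw; refine (@le_integrable _ _ _ mu D mD _ _ _ _ iw).
  exact/measurable_EFinP.
by move=> x Dx /=; rewrite lee_fin vw.
Qed.

Lemma eq_L1 D v w : measurable D -> {in D, v =1 w} -> L1 D v -> L1 D w.
Proof.
move=> mD vw; refine (@eq_integrable _ _ _ mu D mD _ _ _).
by move=> x Dx /=; rewrite vw.
Qed.

Lemma L1D D v w : measurable D -> L1 D v -> L1 D w -> L1 D (v \+ w).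
Proof. by move=> mD iv iw; exact: (@integrableD _ _ _ mu D mD _ _ iv iw). Qed.

Lemma L1Z D k v : measurable D -> L1 D v -> L1 D (fun x => k * v x).
Proof. by move=> mD iv; exact: (@integrableZl _ _ _ mu D mD k _ iv). Qed.

Lemma L1B D v w : measurable D -> L1 D v -> L1 D w -> L1 D (v \- w).
Proof.
move=> mD iv iw; apply: eq_L1 (L1D mD iv (L1Z (-1) mD iw)) => //.
by move=> x _ /=; rewrite mulN1r.
Qed.

Lemma L1_mul_bounded D v w (C : R) : measurable D -> measurable_fun D v ->
  (forall x, D x -> `|v x| <= C) -> L1 D w -> L1 D (fun x => v x * w x).
Proof.
move=> mD mv vC iw; apply: le_L1 (L1Z C mD iw) => //.
  by apply: measurable_funM => //; exact: L1_meas.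
move=> x Dx; rewrite !normrM ler_wpM2r//.
by rewrite (le_trans (vC _ Dx)) ?ler_norm.
Qed.

Lemma L1_cst D (k : R) : measurable D -> (mu D < +oo)%E -> L1 D (cst k).
Proof.
move=> mD Dfin; refine (@measurable_bounded_integrable _ _ _ mu _ _ mD _ _ _) => //.
by exists `|k|; split=> // x kx y _ /=; exact: ltW.
Qed.

Lemma L1S D D' v : measurable D -> measurable D' -> D' `<=` D -> L1 D v -> L1 D' v.
Proof. by move=> mD mD' sD; exact: (@integrableS _ _ _ mu _ _ _ mD mD' sD). Qed.

Lemma L1_mkcond D v : measurable D -> L1 D v <-> L1 setT (v \_ D).
Proof.
move=> mD; rewrite /L1 -restrict_EFin.
exact: (@integrable_mkcond _ _ _ mu D _ mD).
Qed.

Lemma L1_intD D v w : measurable D -> L1 D v -> L1 D w ->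
  \int[mu]_(x in D) (v x + w x) = \int[mu]_(x in D) v x + \int[mu]_(x in D) w x.
Proof. by move=> mD iv iw; exact: (@RintegralD _ _ _ mu D _ _ mD iv iw). Qed.

Lemma L1_intB D v w : measurable D -> L1 D v -> L1 D w ->
  \int[mu]_(x in D) (v x - w x) = \int[mu]_(x in D) v x - \int[mu]_(x in D) w x.
Proof. by move=> mD iv iw; exact: (@RintegralB _ _ _ mu D _ _ mD iv iw). Qed.

Lemma L1_intZ D k v : measurable D -> L1 D v ->
  \int[mu]_(x in D) (k * v x) = k * \int[mu]_(x in D) v x.
Proof. by move=> mD iv; exact: (@RintegralZl _ _ _ mu D _ _ mD iv). Qed.

Lemma L1_le_int D v w : measurable D -> L1 D v -> L1 D w ->
  (forall x, D x -> v x <= w x) ->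
  \int[mu]_(x in D) v x <= \int[mu]_(x in D) w x.
Proof. by move=> mD iv iw; exact: (@le_Rintegral _ _ _ mu D _ _ mD iv iw). Qed.

Lemma L1_fin_num D v : measurable D -> L1 D v ->
  (\int[mu]_(x in D) (v x)%:E)%E \is a fin_num.
Proof. by move=> mD iv; exact: (@integrable_fin_num _ _ _ mu D mD _ iv). Qed.

End L1_theory.

Section L2_theory.
Context {R : realType}.
Implicit Types (D : set R) (f g v w : R -> R).
Local Notation mu := (@lebesgue_measure R).

Lemma L2P D v : measurable D ->
  L2 D v <-> measurable_fun D v /\ L1 D (fun x => v x ^+ 2).
Proof.
move=> mD; rewrite /L2; split.
  move=> Lv; split.
    by move: (Lv); rewrite inE => /andP[/[!inE]/= + _] => /(measurable_restrictT _ mD).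
  have := Lfun2_integrable_sqr Lv.
  rewrite (_ : EFin \o _ = EFin \o (fun x => v x ^+ 2) \_ D); last first.
    by apply/funext => x; rewrite /= !patchE; case: ifP; rewrite //= expr0n.
  by move=> h; exact/L1_mkcond.
move=> [mv iv]; rewrite inE; apply/andP; split; rewrite inE/=.
  exact/(measurable_restrictT _ mD).
rewrite /finite_norm unlock /Lnorm poweR_lty//.
have /integrableP[_] := (L1_mkcond _ mD).1 iv.
congr (_ < _)%E; apply: eq_integral => x _.
rewrite /= !patchE; case: ifP => _ //=.
  by rewrite powR_mulrn// ger0_norm ?sqr_ge0// -normrX ger0_norm ?sqr_ge0.
by rewrite normr0 powR0.
Qed.

Lemma L2_meas D v : measurable D -> L2 D v -> measurable_fun D v.
Proof. by move=> mD /(L2P _ mD)[]. Qed.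

Lemma L2_mul_L1 D v w : measurable D -> L2 D v -> L2 D w -> L1 D (fun x => v x * w x).
Proof.
move=> mD /(L2P _ mD)[mv iv] /(L2P _ mD)[mw iw].
apply: le_L1 (L1D mD iv iw) => //.
  exact: measurable_funM.
move=> x Dx /=; rewrite normrM [leRHS]ger0_norm ?addr_ge0 ?sqr_ge0//.
rewrite -(real_normK (num_real (v x))) -(real_normK (num_real (w x))).
by have := sqr_ge0 (`|v x| - `|w x|); have := normr_ge0 (v x); have := normr_ge0 (w x); nra.
Qed.

Lemma L2D D v w : measurable D -> L2 D v -> L2 D w -> L2 D (v \+ w).
Proof.
move=> mD Lv Lw; have /(L2P _ mD)[mv iv] := Lv; have /(L2P _ mD)[mw iw] := Lw.
apply/(L2P _ mD); split; first exact: measurable_funD.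
apply: eq_L1 (L1D mD (L1D mD iv iw) (L1Z 2 mD (L2_mul_L1 mD Lv Lw))) => //.
by move=> x _ /=; ring.
Qed.

Lemma L2_mul_bounded D v w (C : R) : measurable D -> measurable_fun D v ->
  (forall x, D x -> `|v x| <= C) -> L2 D w -> L2 D (fun x => v x * w x).
Proof.
move=> mD mv vC /(L2P _ mD)[mw iw]; apply/(L2P _ mD); split.
  exact: measurable_funM.
apply: le_L1 (L1Z (C ^+ 2) mD iw) => //.
  by apply: measurable_funX; exact: measurable_funM.
move=> x Dx /=; rewrite exprMn [leLHS]normrM [leRHS]normrM ler_wpM2r//.
have C0 : 0 <= C by apply: le_trans (vC _ Dx).
by rewrite normrX [leRHS]ger0_norm ?sqr_ge0// lerXn2r ?nnegrE// vC.
Qed.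

Lemma L2Z D k v : measurable D -> L2 D v -> L2 D (fun x => k * v x).
Proof. by move=> mD; apply: (@L2_mul_bounded _ (cst k) _ `|k|). Qed.

Lemma L2B D v w : measurable D -> L2 D v -> L2 D w -> L2 D (v \- w).
Proof.
move=> mD Lv Lw; have := L2D mD Lv (L2Z (-1) mD Lw).
by congr L2; apply/funext => x /=; rewrite mulN1r.
Qed.

Lemma L2_bounded D v (C : R) : measurable D -> (mu D < +oo)%E ->
  measurable_fun D v -> (forall x, D x -> `|v x| <= C) -> L2 D v.
Proof.
move=> mD Dfin mv vC; apply/(L2P _ mD); split => //.
apply: le_L1 (L1_cst (C ^+ 2) mD Dfin) => //.
  exact: measurable_funX.
move=> x Dx /=; rewrite normrX [leRHS]ger0_norm ?sqr_ge0//.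
by rewrite lerXn2r ?nnegrE ?vC// (le_trans _ (vC _ Dx)).
Qed.

Lemma L2_L1 D v : measurable D -> (mu D < +oo)%E -> L2 D v -> L1 D v.
Proof.
move=> mD Dfin Lv.
have Lone : L2 D (cst 1) by apply: (@L2_bounded _ _ `|1|).
by apply: eq_L1 (L2_mul_L1 mD Lv Lone) => // x _; rewrite mulr1.
Qed.

Lemma L2S D D' v : measurable D -> measurable D' -> D' `<=` D -> L2 D v -> L2 D' v.
Proof.
move=> mD mD' sD /(L2P _ mD)[mv iv]; apply/(L2P _ mD'); split.
  exact: measurable_funS mv.
exact: L1S iv.
Qed.

Lemma ae_eq_Rintegral D v w : measurable D -> measurable_fun D v -> measurable_fun D w ->
  ae_eq mu D v w -> \int[mu]_(x in D) v x = \int[mu]_(x in D) w x.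
Proof.
move=> mD mv mw vw; congr fine; apply: ae_eq_integral => //.
- exact/measurable_EFinP.
- exact/measurable_EFinP.
- by apply: filterS vw => x /= h Dx; rewrite h.
Qed.

Lemma L1_ae D v w : measurable D -> measurable_fun D w -> ae_eq mu D v w ->
  L1 D v -> L1 D w.
Proof.
move=> mD mw vw iv; have mv := L1_meas mD iv.
move/integrableP : iv => [mv' iv]; apply/integrableP; split.
  exact/measurable_EFinP.
rewrite [X in (X < _)%E](_ : _ = \int[mu]_(x in D) `|(EFin \o v) x|)%E //.
apply: ae_eq_integral => //.
- by apply: measurableT_comp => //; exact/measurable_EFinP.
- by apply: measurableT_comp => //; exact/measurable_EFinP.
- by apply: filterS vw => x /= h Dx; rewrite h.
Qed.

Lemma L2_ae D v w : measurable D -> measurable_fun D w -> ae_eq mu D v w ->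
  L2 D v -> L2 D w.
Proof.
move=> mD mw vw /(L2P _ mD)[mv iv]; apply/(L2P _ mD); split => //.
apply: L1_ae iv => //; first exact: measurable_funX.
by apply: filterS vw => x /= h Dx; rewrite h.
Qed.

Section inner_product.
Variable D : set R.
Hypothesis mD : measurable D.

Lemma ipC v w : ip D v w = ip D w v.
Proof. by apply: eq_Rintegral => x _; rewrite mulrC. Qed.

Lemma eq_ip v v' w w' : {in D, v =1 v'} -> {in D, w =1 w'} -> ip D v w = ip D v' w'.
Proof. by move=> vv ww; apply: eq_Rintegral => x Dx; rewrite vv// ww. Qed.

Lemma ipDl v v' w : L2 D v -> L2 D v' -> L2 D w -> ip D (v \+ v') w = ip D v w + ip D v' w.
Proof.
move=> Lv Lv' Lw; rewrite /ip -(L1_intD mD (L2_mul_L1 mD Lv Lw) (L2_mul_L1 mD Lv' Lw)).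
by apply: eq_Rintegral => x _ /=; rewrite mulrDl.
Qed.

Lemma ipBl v v' w : L2 D v -> L2 D v' -> L2 D w -> ip D (v \- v') w = ip D v w - ip D v' w.
Proof.
move=> Lv Lv' Lw; rewrite /ip -(L1_intB mD (L2_mul_L1 mD Lv Lw) (L2_mul_L1 mD Lv' Lw)).
by apply: eq_Rintegral => x _ /=; rewrite mulrBl.
Qed.

Lemma ipZl k v w : L2 D v -> L2 D w -> ip D (fun x => k * v x) w = k * ip D v w.
Proof.
move=> Lv Lw; rewrite /ip -(L1_intZ _ mD (L2_mul_L1 mD Lv Lw)).
by apply: eq_Rintegral => x _ /=; rewrite mulrA.
Qed.

Lemma ipDr v v' w : L2 D v -> L2 D v' -> L2 D w -> ip D w (v \+ v') = ip D w v + ip D w v'.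
Proof. by move=> *; rewrite ipC ipDl// !(ipC w). Qed.

Lemma ipBr v v' w : L2 D v -> L2 D v' -> L2 D w -> ip D w (v \- v') = ip D w v - ip D w v'.
Proof. by move=> *; rewrite ipC ipBl// !(ipC w). Qed.

Lemma ipZr k v w : L2 D v -> L2 D w -> ip D w (fun x => k * v x) = k * ip D w v.
Proof. by move=> *; rewrite ipC ipZl// !(ipC w). Qed.

Lemma ip_ge0 v : 0 <= ip D v v.
Proof. by apply: Rintegral_ge0 => x _; rewrite -expr2 sqr_ge0. Qed.

Lemma nrm_ge0 v : 0 <= nrm D v. Proof. exact: sqrtr_ge0. Qed.

Lemma nrm_sqr v : nrm D v ^+ 2 = ip D v v.
Proof. by rewrite /nrm sqr_sqrtr// ip_ge0. Qed.

(** The discriminant of the nonnegative quadratic [t |-> |v - t w|^2]; when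
    [|w| = 0] that polynomial is affine in [t], and it can stay nonnegative
    only if its slope vanishes. *)
Lemma cauchy_schwarz v w : L2 D v -> L2 D w -> `|ip D v w| <= nrm D v * nrm D w.
Proof.
move=> Lv Lw; rewrite -(@ler_pXn2r _ 2) ?nnegrE ?mulr_ge0 ?nrm_ge0//.
rewrite exprMn !nrm_sqr real_normK ?num_real//.
have Q (t : R) : 0 <= ip D v v - 2 * t * ip D v w + t ^+ 2 * ip D w w.
  have := ip_ge0 (v \- (fun x => t * w x)).
  have Lt := L2Z t mD Lw; have LB := L2B mD Lv Lt.
  rewrite ipBl// !ipBr// !ipZl// !ipZr// (ipC w v).
  by congr (0 <= _); ring.
have := ip_ge0 w; rewrite le_eqVlt => /predU1P[w0|w0].
  have [->|vw0] := eqVneq (ip D v w) 0; first by rewrite expr0n mulr_ge0 ?ip_ge0.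
  have := Q ((ip D v v + 1) / (2 * ip D v w)); rewrite -w0 mulr0 addr0.
  by rewrite (_ : _ - _ = -1) ?oppr_ge0 ?ler10//; field.
have := Q (ip D v w / ip D w w).
rewrite (_ : _ + _ = ip D v v - ip D v w ^+ 2 / ip D w w); last first.
  by field; rewrite gt_eqF.
by rewrite subr_ge0 ler_pdivrMr.
Qed.

Lemma nrmD v w : L2 D v -> L2 D w -> nrm D (v \+ w) <= nrm D v + nrm D w.
Proof.
move=> Lv Lw; rewrite -(@ler_pXn2r _ 2) ?nnegrE ?addr_ge0 ?nrm_ge0//.
rewrite nrm_sqr ipDl//; last exact: L2D.
rewrite !ipDr// sqrrD !nrm_sqr (ipC w v).
by have := cauchy_schwarz Lv Lw; rewrite ler_norml => /andP[_ ?]; lra.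
Qed.

Lemma nrmZ k v : L2 D v -> nrm D (fun x => k * v x) = `|k| * nrm D v.
Proof.
move=> Lv; rewrite /nrm ipZl ?ipZr//; last exact: L2Z.
by rewrite mulrA -expr2 sqrtrM ?sqr_ge0// sqrtr_sqr.
Qed.

Lemma ae_eq_ip v v' w w' : L2 D v -> L2 D v' -> L2 D w -> L2 D w' ->
  ae_eq mu D v v' -> ae_eq mu D w w' -> ip D v w = ip D v' w'.
Proof.
move=> Lv Lv' Lw Lw' vv ww; apply: ae_eq_Rintegral => //.
- by apply: measurable_funM; exact: L2_meas.
- by apply: measurable_funM; exact: L2_meas.
- by apply: filterS2 vv ww => x /= h1 h2 Dx; rewrite h1// h2.
Qed.

Lemma ae_eq_nrm v v' : L2 D v -> L2 D v' -> ae_eq mu D v v' -> nrm D v = nrm D v'.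
Proof. by move=> Lv Lv' vv; rewrite /nrm (@ae_eq_ip _ v' _ v'). Qed.

Lemma le_ip v w : L2 D v -> L2 D w -> (forall x, D x -> `|v x| <= `|w x|) ->
  ip D v v <= ip D w w.
Proof.
move=> Lv Lw vw; apply: L1_le_int => //; try exact: L2_mul_L1.
move=> x Dx; rewrite -!expr2 -(real_normK (num_real (v x))) -(real_normK (num_real (w x))).
by rewrite lerXn2r ?nnegrE// vw.
Qed.

Lemma le_nrm v w : L2 D v -> L2 D w -> (forall x, D x -> `|v x| <= `|w x|) ->
  nrm D v <= nrm D w.
Proof. by move=> Lv Lw vw; rewrite ler_wsqrtr// le_ip. Qed.

Lemma ip_eq0_ae v : L2 D v -> ip D v v = 0 -> ae_eq mu D v (cst 0).
Proof.
move=> Lv v0; have /(L2P _ mD)[mv iv] := Lv.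
have : (\int[mu]_(x in D) `|(v x * v x)%:E|)%E = 0%E.
  under eq_integral do rewrite gee0_abs ?lee_fin -?expr2 ?sqr_ge0//.
  rewrite -[LHS]fineK; last exact: L1_fin_num.
  by move: v0; rewrite /ip /Rintegral; under eq_integral do rewrite -expr2; move=> ->.
move=> h.
have mvv : measurable_fun D (EFin \o (fun x => v x * v x)).
  by apply/measurable_EFinP; exact: measurable_funM.
have /(_ h) := (ae_eq_integral_abs mu mD mvv).1.
by apply: filterS => x /= + Dx => /(_ Dx)[] /eqP; rewrite mulf_eq0 orbb => /eqP.
Qed.

End inner_product.

Lemma nrmS D D' v : measurable D -> measurable D' -> D' `<=` D -> L2 D v ->
  nrm D' v <= nrm D v.
Proof.
move=> mD mD' sD Lv; rewrite ler_wsqrtr//.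
have iv := L2_mul_L1 mD Lv Lv.
have iv' := L2_mul_L1 mD' (L2S mD mD' sD Lv) (L2S mD mD' sD Lv).
rewrite /ip /Rintegral fine_le//; try exact: L1_fin_num.
apply: ge0_subset_integral => //.
- by apply/measurable_EFinP; exact: (L1_meas mD iv).
- by move=> x _; rewrite lee_fin -expr2 sqr_ge0.
Qed.

End L2_theory.

(** * Integrals over open intervals *)
Section open_interval_integral.
Context {R : realType}.
Implicit Types (f g G H : R -> R) (c d m x : R).
Local Notation mu := (@lebesgue_measure R).

Definition oint c d f : R := \int[mu]_(x in `]c, d[) f x.

Lemma mu_oo_lty c d : (mu `]c, d[ < +oo)%E.
Proof. by rewrite lebesgue_measure_itv/=; case: ifP => _; rewrite ?ltry// -EFinD ltry. Qed.

Lemma subset_oo c c' d d' : c <= c' -> d' <= d -> (`]c', d'[%classic : set R) `<=` `]c, d[.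
Proof. by move=> cc dd; apply: subset_itv; rewrite bnd_simp. Qed.

Lemma L1_oo c c' d d' f : c <= c' -> d' <= d -> L1 `]c, d[ f -> L1 `]c', d'[ f.
Proof. by move=> cc dd; apply: L1S => //; exact: subset_oo. Qed.

Lemma L2_oo c c' d d' f : c <= c' -> d' <= d -> L2 `]c, d[ f -> L2 `]c', d'[ f.
Proof. by move=> cc dd; apply: L2S => //; exact: subset_oo. Qed.

Lemma L2_L1_oo c d f : L2 `]c, d[ f -> L1 `]c, d[ f.
Proof. by apply: L2_L1 => //; exact: mu_oo_lty. Qed.

Lemma mem_oo c d x : (x \in (`]c, d[%classic : set R)) = (c < x < d).
Proof. by apply/idP/idP; rewrite inE/= in_itv/=. Qed.

Lemma oint_nil c f : oint c c f = 0.
Proof. by rewrite /oint set_itv_ge ?Rintegral_set0// bnd_simp ltxx. Qed.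

Lemma eq_oint c d f g : (forall x, c < x < d -> f x = g x) -> oint c d f = oint c d g.
Proof. by move=> fg; apply: eq_Rintegral => x; rewrite inE/= in_itv/=; exact: fg. Qed.

Lemma oint_cst c d k : c <= d -> oint c d (cst k) = k * (d - c).
Proof.
move=> cd; rewrite /oint Rintegral_cst//= lebesgue_measure_itv/=.
move: cd; rewrite le_eqVlt => /predU1P[->|cd]; first by rewrite lte_fin ltxx/= subrr.
by rewrite lte_fin cd.
Qed.

Lemma oint_cat c m d f : c <= m -> m <= d -> L1 `]c, d[ f ->
  oint c d f = oint c m f + oint m d f.
Proof.
move=> cm; rewrite le_eqVlt => /predU1P[->|md] fi; first by rewrite oint_nil addr0.
have fm : L1 `]c, m[ f by apply: L1_oo fi => //; exact: ltW.
rewrite /oint -(Rintegral_itvB (x := m) fi) ?bnd_simp//.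
by rewrite (Rintegral_itv_bndo_bndc fm) addrC subrK.
Qed.

Lemma oint_restrict c d f x : x <= d -> oint c x (f \_ `]c, d[) = oint c x f.
Proof.
move=> xd; apply: eq_oint => t /andP[ct tx]; rewrite patchE mem_set//=.
by rewrite in_itv/= ct (lt_le_trans tx).
Qed.

(** Extending [g] by zero moves the question to the closed interval, where
    the continuity of indefinite integrals is known. *)
Lemma oint_continuous c d g : c <= d -> L1 `]c, d[ g ->
  {within `[c, d], continuous (fun x => oint c x g)}.
Proof.
move=> cd gi; pose gt := g \_ `]c, d[.
have gti : L1 `[c, d] gt.
  by apply: (@L1S _ setT) => //; exact/(L1_mkcond _ _).1.
have E (x : R) : c <= x <= d -> parameterized_integral mu c x gt = oint c x g.
  move=> /andP[cx xd].
  have ix : L1 `[c, x[ gt by apply: L1S gti => //; apply: subset_itvl; rewrite bnd_simp.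
  have ix' : L1 `]c, x[ gt by apply: L1S ix => //; apply: subset_itvr; rewrite bnd_simp.
  rewrite /parameterized_integral -(Rintegral_itv_bndo_bndc ix).
  by rewrite -(Rintegral_itv_obnd_cbnd ix') -(oint_restrict _ _ xd).
have := parameterized_integral_continuous cd gti.
by apply: subspace_eq_continuous => x; rewrite inE/= in_itv/=; exact: E.
Qed.

Lemma continuous_measurable_oo c d G :
  {within `[c, d], continuous G} -> measurable_fun `]c, d[ G.
Proof.
move=> cG; apply: (@measurable_funS _ _ _ _ `[c, d]) => //.
  by apply: subset_itv; rewrite bnd_simp.
exact: subspace_continuous_measurable_fun.
Qed.

Lemma continuous_bounded_oo c d G : {within `[c, d], continuous G} ->
  exists C, forall x, c <= x <= d -> `|G x| <= C.
Proof.
move=> cG.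
have /compact_bounded[M [_ HM]] : compact (G @` `[c, d]).
  by apply: continuous_compact => //; exact: segment_compact.
exists (M + 1) => x cxd; apply: (HM (M + 1)); first by rewrite ltrDl.
by exists x.
Qed.

Lemma continuous_L2_oo c d G : {within `[c, d], continuous G} -> L2 `]c, d[ G.
Proof.
move=> cG; have [C GC] := continuous_bounded_oo cG.
apply: (@L2_bounded _ _ _ C) => //; first exact: mu_oo_lty.
  exact: continuous_measurable_oo.
by move=> x /=; rewrite in_itv/= => /andP[cx xd]; apply: GC; rewrite !ltW.
Qed.

(** Integrate [f x * g y] over the square: the two terms are the integrals
    over the triangles [y < x] and [x < y]. This is integration by parts for
    primitives of functions that are merely integrable. *)
Lemma fubini_triangle c d f g : c <= d -> L1 `]c, d[ f -> L1 `]c, d[ g ->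
  oint c d (fun x => f x * oint c x g) + oint c d (fun y => g y * oint c y f) =
  oint c d f * oint c d g.
Proof.
move=> cd fi gi; pose D : set R := `]c, d[%classic.
pose ft := f \_ D; pose gt := g \_ D.
have mD : measurable D by exact: measurable_itv.
have fti : L1 setT ft := (L1_mkcond f mD).1 fi.
have gti : L1 setT gt := (L1_mkcond g mD).1 gi.
have mft : measurable_fun setT ft by exact: L1_meas fti.
have mgt : measurable_fun setT gt by exact: L1_meas gti.
pose H (z : measurableTypeR R * measurableTypeR R) : R := ft z.1 * gt z.2.
pose F (z : measurableTypeR R * measurableTypeR R) : R :=
  if z.2 < z.1 then H z else 0.
have mH : measurable_fun setT H.
  by apply: measurable_funM; [exact: (measurableT_comp mft)|exact: (measurableT_comp mgt)].
have mF : measurable_fun setT F.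
  by apply: measurable_fun_ifT => //; exact: measurable_fun_ltr.
(* The integrand on the square is dominated by a product, which is integrable. *)
have iH : ((mu \x mu)%E).-integrable setT (EFin \o H).
  apply/integrable12ltyP; first exact/measurable_EFinP.
  have [mf /= flty] := integrableP _ _ _ fti.
  have [mg /= glty] := integrableP _ _ _ gti.
  have E x : (\int[mu]_y `|(EFin \o H) (x, y)| =
      `|(ft x)%:E| * \int[mu]_y `|(gt y)%:E|)%E.
    rewrite -ge0_integralZl//; last exact: measurableT_comp.
    by apply: eq_integral => y _; rewrite /H/= normrM EFinM.
  under eq_integral do rewrite E.
  rewrite ge0_integralZr//; last 2 first.
  - by apply: measurableT_comp.
  - by apply: integral_ge0.
  apply: lte_mul_pinfty => //; first exact: integral_ge0.
  by rewrite ge0_fin_numE//; exact: integral_ge0.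
have iF : ((mu \x mu)%E).-integrable setT (EFin \o F).
  refine (@le_integrable _ _ _ (mu \x mu)%E setT measurableT _ _ _ _ iH).
    exact/measurable_EFinP.
  by move=> z _ /=; rewrite /F; case: ifP => // _; rewrite normr0 lee_fin.
have ftP x : ft x = if c < x < d then f x else 0.
  by rewrite /ft patchE mem_oo.
have gtP x : gt x = if c < x < d then g x else 0.
  by rewrite /gt patchE mem_oo.
have intE (h : R -> R) c' d' k : L1 `]c', d'[ h ->
    (\int[mu]_y (k * (h \_ `]c', d'[) y)%:E = (k * oint c' d' h)%:E)%E.
  move=> hi.
  have hi' : L1 setT (h \_ `]c', d'[) by exact/(L1_mkcond _ _).1.
  have hk := L1Z k measurableT hi'.
  rewrite -[LHS]fineK; last exact: (L1_fin_num measurableT hk).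
  by rewrite -/(Rintegral _ _ _) (L1_intZ _ measurableT hi') /oint -Rintegral_mkcond.
have E1 x : (\int[mu]_y (F (x, y))%:E =
    (((fun x => (f x * oint c x g)%R) \_ D) x)%:E)%E.
  rewrite patchE mem_oo; case: ifPn => [/andP[cx xd]|cxd]; last first.
    apply: integral0_eq => y _; rewrite /F /H /= ftP (negbTE cxd) mul0r.
    by case: ifP.
  rewrite -intE; last by apply: L1_oo gi => //; exact: ltW.
  apply: eq_integral => y _; rewrite /F /H /= ftP cx xd/= gtP patchE mem_oo.
  case: ltP => yx; rewrite ?andbT ?andbF ?mulr0//.
  by rewrite (lt_trans yx xd) andbT; case: ifP.
have E2 y : (\int[mu]_x (F (x, y))%:E =
    (((fun y => (g y * (oint c d f - oint c y f))%R) \_ D) y)%:E)%E.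
  rewrite patchE mem_oo; case: ifPn => [/andP[cy yd]|cyd]; last first.
    apply: integral0_eq => x _; rewrite /F /H /= gtP (negbTE cyd) mulr0.
    by case: ifP.
  rewrite (@oint_cat c y d)// ?ltW// addrAC subrr add0r.
  rewrite -intE; last by apply: L1_oo fi => //; exact: ltW.
  apply: eq_integral => x _; rewrite /F /H /= gtP cy yd/= ftP patchE mem_oo.
  case: ltP => yx; rewrite ?andFb ?mulr0//=.
  by rewrite (lt_trans cy yx)/= mulrC; case: ifP; rewrite ?mulr0.
have := Fubini iF.
rewrite /=.
under eq_integral do rewrite E1.
under [in RHS]eq_integral do rewrite E2.
move=> /(congr1 fine); rewrite -/(Rintegral _ _ _) -/(Rintegral _ _ _).
rewrite -!Rintegral_mkcond -/(oint _ _ _) -/(oint _ _ _) => ->.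
have [C oC] := continuous_bounded_oo (oint_continuous cd fi).
have mo := continuous_measurable_oo (oint_continuous cd fi).
have i1 : L1 D (fun y => oint c y f * g y).
  apply: (@L1_mul_bounded _ _ _ _ C) => //.
  by move=> x; rewrite /D/= in_itv/= => /andP[? ?]; apply: oC; rewrite !ltW.
rewrite (_ : oint c d (fun y => _ * (_ - _)) =
    \int[mu]_(y in D) (oint c d f * g y - oint c y f * g y)); last first.
  by apply: eq_oint => x _; ring.
rewrite L1_intB//; last exact: L1Z.
rewrite L1_intZ// -/(oint _ _ _) -/(oint _ _ _).
rewrite -addrA [X in _ + X](_ : _ = 0) ?addr0//.
by rewrite addrC; apply/eqP; rewrite subr_eq0; apply/eqP/eq_oint => x _; rewrite mulrC.
Qed.

Lemma L2_patch (D E : set R) v : measurable D -> L2 E v -> L2 D (v \_ E).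
Proof.
move=> mD Lv; apply: (@L2S _ setT) => //.
by rewrite /L2 patch_setT.
Qed.

Lemma L2_cat c y d v : L2 `]c, y[ v -> L2 `]y, d[ v -> L2 `]c, d[ v.
Proof.
move=> L1v L2v; have mD : measurable (`]c, d[%classic : set R) by [].
have Ly : L2 `]c, d[ (fun x => v y * \1_([set y] : set R) x).
  apply: (@L2_bounded _ _ _ `|v y|) => //; first exact: mu_oo_lty.
    apply: measurable_funM => //; exact: measurable_indic.
  move=> x _; rewrite normrM ler_piMr// indicE.
  by case: (_ \in _); rewrite ?normr1 ?normr0.
have := L2D mD (L2D mD (L2_patch mD L1v) (L2_patch mD L2v)) Ly.
have E : {in (`]c, d[%classic : set R), v =1
    ((v \_ `]c, y[) \+ (v \_ `]y, d[)) \+ (fun x => v y * \1_([set y] : set R) x)}.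
  move=> x; rewrite mem_oo /= !patchE !mem_oo indicE => /andP[cx xd].
  have [xy|yx|->] := ltgtP x y.
  - by rewrite cx memNset ?mulr0 ?addr0//= => /eqP; rewrite lt_eqF.
  - by rewrite xd andbF memNset ?mulr0 ?addr0 ?add0r//= => /eqP; rewrite gt_eqF.
  - by rewrite andbF mem_set// mulr1 !add0r.
move=> /(L2P _ mD)[mw iw]; apply/(L2P _ mD); split.
  by apply: eq_measurable_fun mw => x /E.
by apply: eq_L1 iw => // x /E <-.
Qed.

End open_interval_integral.

(** * Absolutely continuous functions with square-integrable derivative *)
Section abscont.
Context {R : realType}.
Implicit Types (f g h G H phi : R -> R) (c d m x : R).
Local Notation mu := (@lebesgue_measure R).

(** These are the continuous representatives of the elements of [H^1(c, d)];
    [g] is determined by [G] up to null sets only, hence a relation. Unlike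
    [H1], it has values at the endpoints, so boundary terms make sense. *)
Definition abscont c d G g : Prop :=
  L2 `]c, d[ g /\ forall x, c <= x <= d -> G x = G c + oint c x g.

Lemma abscont_L1 c d G g : abscont c d G g -> L1 `]c, d[ g.
Proof. by move=> [Lg _]; exact: L2_L1_oo. Qed.

Lemma abscont_ae c d G g g' : measurable_fun `]c, d[ g' -> ae_eq mu `]c, d[%classic g g' ->
  abscont c d G g -> abscont c d G g'.
Proof.
move=> mg' gg' [Lg GE]; split; first exact: L2_ae gg' Lg.
move=> x /[dup] cxd /andP[cx xd]; rewrite GE//; congr (_ + _).
have sx : (`]c, x[%classic : set R) `<=` `]c, d[ by exact: subset_oo.
apply: ae_eq_Rintegral => //.
- by apply: measurable_funS (L2_meas _ Lg) => //.
- by apply: measurable_funS mg' => //.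
- by apply: filterS gg' => t /= ht tx; apply: ht; exact: sx.
Qed.

Lemma abscont_continuous c d G g : c <= d -> abscont c d G g -> {within `[c, d], continuous G}.
Proof.
move=> cd HG; have := oint_continuous cd (abscont_L1 HG).
move=> oc.
have : {within `[c, d], continuous (fun x => G c + oint c x g)}.
  by move=> x; apply: cvgD; [exact: cvg_cst|exact: oc].
apply: subspace_eq_continuous => x; rewrite inE/= in_itv/= => cxd.
by case: HG => _ /(_ x cxd) GE; exact: esym.
Qed.

Lemma abscont_sub c d c' d' G g : c <= c' -> c' <= d' -> d' <= d ->
  abscont c d G g -> abscont c' d' G g.
Proof.
move=> cc cd dd HG; have gi := abscont_L1 HG; case: HG => Lg GE; split.
  exact: L2_oo Lg.
move=> x /andP[cx xd]; rewrite GE; last by rewrite (le_trans cc) ?(le_trans xd).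
rewrite (GE c'); last by rewrite cc (le_trans cx) ?(le_trans xd).
rewrite -addrA -(@oint_cat _ c c' x)//.
by apply: L1_oo gi => //; exact: le_trans dd.
Qed.

Lemma abscont_cat c m d G g : c <= m -> m <= d ->
  abscont c m G g -> abscont m d G g -> abscont c d G g.
Proof.
move=> cm md [Lg1 G1] [Lg2 G2].
have Lg : L2 `]c, d[ g by exact: L2_cat Lg1 Lg2.
split=> // x /andP[cx xd].
have [xm|mx] := leP x m; first by rewrite G1 ?cx.
rewrite G2 ?(ltW mx)// G1 ?cm ?lexx// -addrA -oint_cat ?(ltW mx)//.
by apply: L1_oo (L2_L1_oo Lg).
Qed.

Lemma abscont_cst c d k : abscont c d (cst k) (cst 0).
Proof.
split.
  by apply: (@L2_bounded _ _ _ 0) => //; [exact: mu_oo_lty|move=> x _; rewrite normr0].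
by move=> x /andP[cx xd]; rewrite oint_cst// mul0r addr0.
Qed.

Lemma abscont_add c d G H g h : abscont c d G g -> abscont c d H h -> abscont c d (G \+ H) (g \+ h).
Proof.
move=> AG AH; have gi := abscont_L1 AG; have hi := abscont_L1 AH.
case: AG AH => [Lg GE] [Lh HE]; split; first exact: L2D.
move=> x /[dup] cxd /andP[cx xd] /=; rewrite GE// HE// /oint L1_intD//; first by ring.
  exact: L1_oo gi.
exact: L1_oo hi.
Qed.

Lemma abscont_primitive c d k g : L2 `]c, d[ g -> abscont c d (fun x => k + oint c x g) g.
Proof. by move=> Lg; split=> // x cxd; rewrite oint_nil addr0. Qed.

(** Writing [G] and [H] as constants plus primitives, the only term that is
    not linear is the product of two primitives, which [fubini_triangle]
    computes. *)
Lemma abscont_mul c d G H g h : c <= d -> abscont c d G g -> abscont c d H h ->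
  abscont c d (G \* H) (fun x => g x * H x + G x * h x).
Proof.
move=> cd AG AH; have cG := abscont_continuous cd AG; have cH := abscont_continuous cd AH.
have gi := abscont_L1 AG; have hi := abscont_L1 AH.
case: AG AH => [Lg GE] [Lh HE].
have [CG GC] := continuous_bounded_oo cG; have [CH HC] := continuous_bounded_oo cH.
have oob (P : R -> Prop) : (forall x, c <= x <= d -> P x) ->
    forall x, x \in `]c, d[ -> P x.
  by move=> HP x; rewrite in_itv/= => /andP[? ?]; apply: HP; rewrite !ltW.
split.
  apply: L2D => //.
    rewrite (_ : (fun x => g x * H x) = (fun x => H x * g x)); last first.
      by apply/funext => x; rewrite mulrC.
    by apply: (L2_mul_bounded (C := CH)) => //;
      [exact: continuous_measurable_oo|exact: oob].
  by apply: (L2_mul_bounded (C := CG)) => //;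
    [exact: continuous_measurable_oo|exact: oob].
move=> x /[dup] cxd /andP[cx xd].
have gx : L1 `]c, x[ g by exact: L1_oo gi.
have hx : L1 `]c, x[ h by exact: L1_oo hi.
have prod_int u v : L1 `]c, x[ u -> L1 `]c, x[ v -> L1 `]c, x[ (fun t => u t * oint c t v).
  move=> iu iv; have co := oint_continuous cx iv.
  have [C oC] := continuous_bounded_oo co.
  apply: eq_L1 (L1_mul_bounded (C := C) _ (continuous_measurable_oo co) _ iu) => //.
    by move=> t _ /=; rewrite mulrC.
  by move=> t /=; rewrite in_itv/= => /andP[? ?]; apply: oC; rewrite !ltW.
rewrite (@eq_oint _ c x _ (fun t => (H c * g t + G c * h t) +
    (g t * oint c t h + h t * oint c t g))); last first.
  move=> t /andP[ct tx]; rewrite (GE t) ?(HE t) ?(ltW ct) ?(le_trans (ltW tx))//; ring.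
rewrite /oint L1_intD//; last 2 first.
- by apply: L1D => //; exact: L1Z.
- by apply: L1D => //; exact: prod_int.
rewrite L1_intD//; [|exact: L1Z|exact: L1Z].
rewrite !L1_intZ// L1_intD//; [|exact: prod_int|exact: prod_int].
have := fubini_triangle cx gx hx; rewrite /oint => ->.
by rewrite -!/(oint _ _ _) /= (GE x)// (HE x)//; ring.
Qed.

Lemma abscont_derive c d phi f : c <= d ->
  (forall x, c <= x <= d -> is_derive x 1 phi (f x)) ->
  {within `[c, d], continuous f} -> abscont c d phi f.
Proof.
move=> cd dphi cf; split; first exact: continuous_L2_oo.
move=> x /andP[]; rewrite le_eqVlt => /predU1P[<- _|cx xd].
  by rewrite oint_nil addr0.
have phic t : c <= t <= d -> phi @ t --> phi t.
  move=> /dphi[df _]; apply: differentiable_continuous; exact/derivable1_diffP.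
have cfx : {within `[c, x], continuous f}.
  by apply: continuous_subspaceW cf; apply: subset_itvl; rewrite bnd_simp.
have i : L1 `[c, x] f.
  by apply: continuous_compact_integrable => //; exact: segment_compact.
have i1 : L1 `[c, x[ f by apply: L1S i => //; apply: subset_itvl; rewrite bnd_simp.
have i2 : L1 `]c, x[ f by apply: L1S i1 => //; apply: subset_itvr; rewrite bnd_simp.
have oo t : t \in `]c, x[ -> c <= t <= d.
  by rewrite in_itv/= => /andP[/ltW -> /ltW/le_trans ->].
rewrite /oint (Rintegral_itv_obnd_cbnd i2) (Rintegral_itv_bndo_bndc i1) /Rintegral.
rewrite (@continuous_FTC2 _ f phi c x cx cfx).
- by rewrite -EFinB /= addrCA subrr addr0.
- split; first by move=> t /oo/dphi[].
    by apply/cvg_at_right_filter/phic; rewrite lexx.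
  by apply/cvg_at_left_filter/phic; rewrite (ltW cx).
- by move=> t /oo/dphi[_]; rewrite derive1E.
Qed.

Lemma abscont_C1 c d phi : c <= d -> (forall x, derivable phi x 1) ->
  continuous (derive1 phi) -> abscont c d phi (derive1 phi).
Proof.
move=> cd dphi cphi; refine (abscont_derive cd _ (continuous_subspaceT cphi)).
by move=> x _; split; [exact: (dphi x)|rewrite derive1E].
Qed.

End abscont.

(** * Weak derivatives *)
Section weak_derivatives.
Context {R : realType}.
Implicit Types (f g h G H phi psi v : R -> R) (c d m x : R).
Local Notation mu := (@lebesgue_measure R).

Lemma ip_oint c d v w : ip `]c, d[ v w = oint c d (fun x => v x * w x).
Proof. by []. Qed.

Lemma C1c_out c d phi x : C1c `]c, d[ phi -> ~~ (c < x < d) -> phi x = 0.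
Proof.
move=> [_ _ _ sub]; apply: contraNeq => px.
have /sub : closure [set x | phi x != 0] x by exact: subset_closure.
by rewrite /= in_itv.
Qed.

Lemma C1c_abscont c d phi : c <= d -> C1c `]c, d[ phi -> abscont c d phi (derive1 phi).
Proof. by move=> cd [dp cp _ _]; refine (abscont_C1 cd dp cp). Qed.

Lemma abscont_by_parts c d G H g h : c <= d -> abscont c d G g -> abscont c d H h ->
  oint c d (fun x => g x * H x) + oint c d (fun x => G x * h x) =
  G d * H d - G c * H c.
Proof.
move=> cd AG AH; have [_ /(_ d)] := abscont_mul cd AG AH.
rewrite lexx cd => /(_ isT) /= ->.
have LG := continuous_L2_oo (abscont_continuous cd AG).
have LH := continuous_L2_oo (abscont_continuous cd AH).
case: AG AH => [Lg _] [Lh _].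
rewrite /oint L1_intD//; [by ring|exact: L2_mul_L1|exact: L2_mul_L1].
Qed.

(** The boundary terms of the integration by parts vanish because a test
    function is zero at the endpoints. *)
Lemma abscont_weak c d G g : c <= d -> abscont c d G g -> weak_derivative `]c, d[ G g.
Proof.
move=> cd AG; split; first by case: AG.
move=> phi Cphi; have := abscont_by_parts cd AG (C1c_abscont cd Cphi).
rewrite !(C1c_out Cphi) ?ltxx ?andbF// !mulr0 subrr => /eqP.
by rewrite addrC addr_eq0 => /eqP.
Qed.

(** Lebesgue differentiation: a.e. the integrand is the derivative of its
    primitive, here the zero function. *)
Lemma oint_eq0_ae c d g : L1 `]c, d[ g ->
  (forall x, c <= x <= d -> oint c x g = 0) -> ae_eq mu `]c, d[%classic g (cst 0).
Proof.
move=> gi g0; pose gt := g \_ `]c, d[.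
have gti : L1 setT gt by apply/(L1_mkcond _ _).1.
have loc : locally_integrable [set: R] gt by exact: integrable_locally.
have int y : mu.-integrable [set` Interval (BRight c) (BRight y)] (EFin \o gt).
  by apply: (@L1S _ setT).
have F0 : (fun x => \int[mu]_(t in [set` Interval (BRight c) (BRight x)]) gt t) = cst 0.
  apply/funext => x; have ix : L1 `]c, x[ gt by exact: (@L1S _ setT).
  rewrite -(Rintegral_itv_bndo_bndc ix) -/(oint _ _ _) /=.
  have [xc|cx] := leP x c.
    by rewrite /oint set_itv_ge ?Rintegral_set0// bnd_simp -leNgt.
  have [xd|dx] := leP x d; first by rewrite oint_restrict// g0// ltW.
  have [cd|dc] := leP c d.
    rewrite (@oint_cat _ c d x)// ?ltW// oint_restrict// g0 ?cd ?lexx// add0r.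
    rewrite (@eq_oint _ d x _ (cst 0)) ?oint_cst ?mul0r ?ltW//.
    by move=> t /andP[dt _]; rewrite /gt patchE mem_oo [t < d]ltNge (ltW dt)/= andbF.
  rewrite (@eq_oint _ c x _ (cst 0)) ?oint_cst ?mul0r ?ltW//.
  by move=> t /andP[ct _]; rewrite /gt patchE mem_oo [t < d]ltNge (ltW (lt_trans dc ct))/= andbF.
have := FTC1 int loc.
apply: filterS; first exact: (ae_filter_ringOfSetsType mu).
move=> x /= + xcd.
move: (xcd); rewrite /= in_itv/= => /andP[cx xd].
have cx' : (BRight c < BRight x)%O by rewrite bnd_simp.
move=> /(_ cx')[_]; rewrite F0 derive1_cst.
by rewrite /gt patchE mem_oo cx xd /= => <-.
Qed.

(** The support condition is stated by a closed interval inside [(c, d)]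
    rather than by a closure: it is what the constructions below produce. *)
Definition Cc c d psi : Prop := continuous psi /\
  exists x' y', [/\ c < x', y' < d & forall t, psi t != 0 -> x' <= t <= y'].

Lemma Cc_lin c d psi th k : Cc c d psi -> Cc c d th -> Cc c d (fun t => psi t - k * th t).
Proof.
move=> [cp [x1 [y1 [cx1 yd1 s1]]]] [ct [x2 [y2 [cx2 yd2 s2]]]]; split.
  by move=> t; apply: cvgB; [exact: cp|apply: cvgM; [exact: cvg_cst|exact: ct]].
exists (Num.min x1 x2), (Num.max y1 y2); rewrite lt_min cx1 cx2 gt_max yd1 yd2.
split=> // t; rewrite ge_min le_max.
have [p0|/s1/andP[-> ->]//] := eqVneq (psi t) 0.
rewrite p0 sub0r oppr_eq0 mulf_eq0 negb_or => /andP[_ /s2/andP[-> ->]].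
by rewrite !orbT.
Qed.

(** These functions vanish at distance less than [1/n] from the complement of
    [(x, y)] and increase to its indicator as [n] grows. *)
Definition plateau (x y : R) (n : nat) (t : R) : R :=
  Num.max 0 (Num.min 1 (n%:R * Num.min (t - x) (y - t) - 1)).

Lemma Cc_plateau c d x y n : c <= x -> y <= d -> Cc c d (plateau x y n.+1).
Proof.
move=> cx yd; split.
  move=> t.
  apply: (@continuous_max _ _ (cst 0)
    (fun t => Num.min 1 (n.+1%:R * Num.min (t - x) (y - t) - 1))); first exact: cvg_cst.
  apply: (@continuous_min _ _ (cst 1)
    (fun t => n.+1%:R * Num.min (t - x) (y - t) - 1)); first exact: cvg_cst.
  apply: cvgB; last exact: cvg_cst.
  apply: cvgM; first exact: cvg_cst.
  apply: (@continuous_min _ _ (fun t => t - x) (fun t => y - t)).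
    by apply: cvgB => //; exact: cvg_cst.
  by apply: cvgB => //; exact: cvg_cst.
have n0 : 0 < (n.+1%:R : R)^-1 by rewrite invr_gt0.
exists (x + n.+1%:R^-1), (y - n.+1%:R^-1); split.
- by rewrite (le_lt_trans cx)// ltrDl.
- by rewrite (lt_le_trans _ yd)// gtrDl oppr_lt0.
- move=> t; rewrite /plateau; apply: contraR => h; apply/eqP/max_idPl.
  rewrite ge_min subr_le0 -ler_pdivlMl// mulr1 ge_min; apply/orP; right.
  move: h; rewrite negb_and -!ltNge => /orP[] h; apply/orP; [left|right].
    by rewrite lerBlDl ltW.
  by rewrite lerBlDr -lerBlDl ltW.
Qed.

Lemma plateau_bound x y n t : `|plateau x y n t| <= 1.
Proof.
rewrite /plateau ger0_norm ?le_max ?lexx//.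
by rewrite ge_max ler01 ge_min lexx.
Qed.

Lemma plateau_cvg x y t : x < t < y -> \forall n \near \oo, plateau x y n.+1 t = 1.
Proof.
move=> /andP[xt ty]; have m0 : 0 < Num.min (t - x) (y - t) by rewrite lt_min !subr_gt0 xt.
near=> n; rewrite /plateau (min_idPl _) ?(max_idPr _) ?ler01//.
rewrite lerBrDr -ler_pdivrMr//.
rewrite (le_trans (_ : _ <= n%:R)) ?ler_nat//.
near: n; exact: nbhs_infty_ger.
Unshelve. all: by end_near. Qed.

(** The indicator of [(c, x)] is a limit of plateau functions, dominated by 1,
    so dominated convergence transfers the orthogonality to it. *)
Lemma Cc_oint_eq0 c d g : L1 `]c, d[ g ->
  (forall psi, Cc c d psi -> oint c d (fun t => g t * psi t) = 0) ->
  forall x, c <= x <= d -> oint c x g = 0.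
Proof.
move=> gi g0 x /andP[cx xd].
pose fn n t := (g t * plateau c x n.+1 t)%:E.
have Cp n := Cc_plateau n (lexx c) xd.
have gx : L1 `]c, x[ g by exact: L1_oo gi.
have mg : measurable_fun `]c, x[ g by exact: L1_meas gx.
have mp n : measurable_fun `]c, x[ (plateau c x n.+1).
  by apply: measurable_funTS; apply: continuous_measurable_fun; case: (Cp n).
have fn0 n : (\int[mu]_(t in `]c, x[) fn n t)%E = 0.
  have fni : L1 `]c, x[ (fun t => g t * plateau c x n.+1 t).
    apply: (@eq_L1 _ _ (fun t => plateau c x n.+1 t * g t)) => //.
      by move=> t _; rewrite mulrC.
    by apply: (@L1_mul_bounded _ _ _ _ 1) => // t _; exact: plateau_bound.
  rewrite -[LHS]fineK; last exact: (L1_fin_num _ fni).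
  congr EFin; rewrite -[RHS](g0 _ (Cp n)) -/(Rintegral _ _ _) -/(oint _ _ _).
  have fnd : L1 `]c, d[ (fun t => g t * plateau c x n.+1 t).
    apply: (@eq_L1 _ _ (fun t => plateau c x n.+1 t * g t)) => //.
      by move=> t _; rewrite mulrC.
    apply: (@L1_mul_bounded _ _ _ _ 1) => // [|t _]; last exact: plateau_bound.
    by apply: measurable_funTS; apply: continuous_measurable_fun; case: (Cp n).
  rewrite [RHS](@oint_cat _ c x d)// [X in _ + X](@eq_oint _ x d _ (cst 0)).
    by rewrite oint_cst// mul0r addr0.
  move=> t /andP[xt _] /=; rewrite (_ : plateau _ _ _ _ = 0) ?mulr0//.
  apply/max_idPl; rewrite ge_min; apply/orP; right.
  rewrite subr_le0; apply: le_trans ler01.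
  by rewrite pmulr_rle0// ge_min !subr_le0 (ltW xt) orbT.
have := @dominated_cvg _ _ _ mu `]c, x[%classic (measurable_itv _) fn (EFin \o g)
  (fun t => `|g t|%:E).
have -> : (fun n => \int[mu]_(t in `]c, x[) fn n t)%E = cst 0%E by apply/funext.
move=> H.
have : cst 0%E @ \oo --> (\int[mu]_(t in `]c, x[) (g t)%:E)%E.
  apply: H.
  - by move=> n; have := measurable_funM mg (mp n); move/measurable_EFinP.
  - move=> t /=; rewrite in_itv/= => tcx; apply: cvg_near_cst.
    by near=> n; rewrite /fn (near (plateau_cvg tcx) n)// mulr1.
  - by [].
  - exact: (integrable_norm gx).
  - move=> n t _; by rewrite /fn lee_fin normrM ler_piMr// plateau_bound.
move=> H2; have := cvg_unique (@ereal_hausdorff R) H2 (@cvg_cst _ _ _ _ _).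
by rewrite /oint /Rintegral => ->.
Unshelve. all: by end_near. Qed.

Lemma Cc_eq0_ae c d g : L1 `]c, d[ g ->
  (forall psi, Cc c d psi -> oint c d (fun t => g t * psi t) = 0) ->
  ae_eq mu `]c, d[%classic g (cst 0).
Proof. by move=> gi g0; apply: oint_eq0_ae => //; exact: Cc_oint_eq0. Qed.

(** The primitive vanishes to the left of the support, and also to its right
    because the total integral is zero. Integrating from minus infinity makes
    it differentiable on the whole line. *)
Lemma Cc_primitive c d psi : Cc c d psi -> oint c d psi = 0 ->
  exists2 phi, C1c `]c, d[ phi & derive1 phi = psi.
Proof.
move=> [cpsi [x [y [cx yd spsi]]]] psi0.
have psi_out t : ~~ (x <= t <= y) -> psi t = 0.
  by apply: contraNeq => /spsi.
have psii : L1 setT psi.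
  have i1 : L1 `[x, y] psi.
    apply: continuous_compact_integrable; first exact: segment_compact.
    exact: continuous_subspaceT.
  have := (L1_mkcond psi (measurable_itv `[x, y])).1 i1.
  apply: eq_L1 => // t _; rewrite patchE; case: ifPn => //.
  by rewrite notin_setE/= in_itv/= => /negP h; rewrite psi_out.
pose phi t := \int[mu]_(s in `]-oo, t]) psi s.
have dphi t : derivable phi t 1 /\ derive1 phi t = psi t.
  apply: (@continuous_FTC1 _ psi -oo%O t (t + 1)) => //.
  - by rewrite ltrDl.
  - by apply: (@L1S _ setT).
  - by rewrite ltNyr.
  - exact: cpsi.
have phiE : derive1 phi = psi by apply/funext => t; case: (dphi t).
have supp t : phi t != 0 -> x <= t <= y.
  apply: contraR; rewrite negb_and -!ltNge => /orP[tx|yt].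
    rewrite /phi (@eq_Rintegral _ _ _ _ _ (cst 0)) ?Rintegral_cst ?mul0r// => s.
    rewrite inE/= in_itv/= => st; apply: psi_out; rewrite negb_and -!ltNge.
    by rewrite (le_lt_trans st tx).
  apply/eqP; rewrite /phi -[RHS]psi0 /oint Rintegral_mkcond [RHS]Rintegral_mkcond.
  congr (Rintegral _ _ _); apply/funext => s; rewrite !patchE mem_oo.
  have [/andP[xs sy]|/psi_out ps] := boolP (x <= s <= y).
    rewrite (lt_le_trans cx xs) (le_lt_trans sy yd)/= mem_set//= in_itv/=.
    by rewrite (le_trans sy (ltW yt)).
  by rewrite ps; case: ifP; case: ifP.
have cl : closure [set t | phi t != 0] `<=` `[x, y].
  rewrite [X in _ `<=` X](closure_id _).1; last exact: itv_closed.
  by apply: closureS => t /supp; rewrite /= in_itv.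
exists phi => //; split.
- by move=> t; case: (dphi t).
- by rewrite phiE.
- by apply: subclosed_compact cl; [exact: closed_closure|exact: segment_compact].
- by apply: subset_trans cl _; apply: subset_itv; rewrite bnd_simp.
Qed.

(** Du Bois-Reymond: fix [th] with nonzero integral. Any [psi] minus its
    multiple of [th] with the same integral is the derivative of a test
    function, so [v] is orthogonal to it; hence [v - k] is orthogonal to all
    [psi] when [k] is the [th]-average of [v]. *)
Lemma weakly_constant c d v : c < d -> L1 `]c, d[ v ->
  (forall phi, C1c `]c, d[ phi -> oint c d (fun x => v x * derive1 phi x) = 0) ->
  exists k, ae_eq mu `]c, d[%classic v (cst k).
Proof.
move=> cd vi v0.
have [[th Cth th0]|nth] := pselect (exists2 th, Cc c d th & oint c d th != 0); last first.
  (* If all integrals were zero, so would be the integral of 1. *)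
  have : oint c d (cst 1) = 0.
    apply: (@Cc_oint_eq0 c d); rewrite ?lexx ?(ltW cd)//.
      by apply: L1_cst => //; exact: mu_oo_lty.
    move=> psi Cpsi; apply/eqP; apply: contra_notT nth => h.
    by exists psi => //; apply: contraNneq h => h; rewrite -[X in _ == X]h; apply/eqP/eq_oint => x _; rewrite mul1r.
  by rewrite oint_cst ?ltW// mul1r => /eqP; rewrite subr_eq0 gt_eqF.
have Cc_L1 psi w : Cc c d psi -> L1 `]c, d[ w -> L1 `]c, d[ (fun x => w x * psi x).
  move=> [cpsi _] wi; have cs : {within `[c, d], continuous psi} by exact: continuous_subspaceT.
  have [C psiC] := continuous_bounded_oo cs.
  apply: (@eq_L1 _ _ (fun x => psi x * w x)) => //; first by move=> x _; rewrite mulrC.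
  apply: (@L1_mul_bounded _ _ _ _ C) => //; first exact: continuous_measurable_oo.
  by move=> x /=; rewrite in_itv/= => /andP[? ?]; apply: psiC; rewrite !ltW.
have i1 : L1 `]c, d[ (cst 1) by apply: L1_cst => //; exact: mu_oo_lty.
have Cc_L1' psi : Cc c d psi -> L1 `]c, d[ psi.
  by move=> Cpsi; apply: eq_L1 (Cc_L1 _ _ Cpsi i1) => // x _; rewrite mul1r.
pose k := oint c d (fun x => v x * th x) / oint c d th.
exists k.
have vki : L1 `]c, d[ (fun x => v x - k).
  by apply: L1B => //; apply: L1_cst => //; exact: mu_oo_lty.
suff h : ae_eq mu `]c, d[%classic (fun x => v x - k) (cst 0).
  apply: filterS h.
  by move=> x /= + xcd => /(_ xcd)/eqP; rewrite subr_eq0 => /eqP.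
apply: Cc_eq0_ae => // psi Cpsi.
pose r := oint c d psi / oint c d th.
have Cr := Cc_lin r Cpsi Cth.
have r0 : oint c d (fun t => psi t - r * th t) = 0.
  rewrite /oint L1_intB//; [|exact: Cc_L1'|by apply: L1Z => //; exact: Cc_L1'].
  by rewrite L1_intZ//; [rewrite -!/(oint _ _ _) /r divfK// subrr|exact: Cc_L1'].
have [phi Cphi phiE] := Cc_primitive Cr r0.
have := v0 _ Cphi; rewrite phiE.
rewrite (@eq_oint _ _ _ _ (fun x => v x * psi x - r * (v x * th x))); last first.
  by move=> x _; ring.
rewrite /oint L1_intB//; [|exact: Cc_L1|by apply: L1Z => //; exact: Cc_L1].
rewrite L1_intZ//; last exact: Cc_L1.
move=> h; rewrite -/(oint _ _ _).
rewrite (@eq_oint _ _ _ _ (fun x => v x * psi x - k * psi x)); last first.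
  by move=> x _; ring.
rewrite /oint L1_intB//; [|exact: Cc_L1|by apply: L1Z => //; exact: Cc_L1'].
rewrite L1_intZ//; last exact: Cc_L1'.
by move: h; rewrite -!/(oint _ _ _) /k /r => <-; field.
Qed.

(** [K^2] has derivative [2 K h], which is zero a.e., so it is constant; and
    its integral is zero. *)
Lemma abscont_ae0 c d K h : c < d -> abscont c d K h ->
  ae_eq mu `]c, d[%classic K (cst 0) -> forall x, c <= x <= d -> K x = 0.
Proof.
move=> cd AK K0.
have cK := abscont_continuous (ltW cd) AK.
have [L2h E] := abscont_mul (ltW cd) AK AK.
have KK x : c <= x <= d -> K x * K x = K c * K c.
  move=> /[dup] cxd /andP[cx xd]; have /= -> := E x cxd; rewrite -[RHS]addr0; congr (_ + _).
  have sx : (`]c, x[%classic : set R) `<=` `]c, d[ by exact: subset_oo.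
  rewrite -(mul0r (x - c)) -oint_cst//; apply: ae_eq_Rintegral => //.
    exact: measurable_funS (L2_meas _ L2h).
  apply: filterS K0.
  by move=> t /= ht /sx/ht ->; rewrite mulr0 mul0r addr0.
have : oint c d (cst (K c * K c)) = oint c d (cst 0).
  apply: ae_eq_Rintegral => //.
  apply: filterS K0.
  move=> t /= ht /[dup] tcd; rewrite in_itv/= => /andP[ct td].
  by rewrite -(KK t) ?ltW// ht// mul0r.
rewrite !oint_cst ?(ltW cd)// mul0r => /eqP.
rewrite mulf_eq0 subr_eq0 (gt_eqF cd) orbF => /eqP Kc x /KK.
by rewrite Kc => /eqP; rewrite mulf_eq0 orbb => /eqP.
Qed.

(** A primitive of the difference is weakly constant, hence constant. *)
Lemma weak_unique c d v g g' : c < d -> weak_derivative `]c, d[ v g ->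
  weak_derivative `]c, d[ v g' -> ae_eq mu `]c, d[%classic g g'.
Proof.
move=> cd [Lg wg] [Lg' wg'].
have mD : measurable (`]c, d[%classic : set R) by [].
have Lh := L2B mD Lg Lg'; pose h := g \- g'.
have AH := abscont_primitive 0 Lh; set H := (fun x => _) in AH.
have LH := continuous_L2_oo (abscont_continuous (ltW cd) AH).
have [|k Hk] := weakly_constant cd (L2_L1_oo LH).
  move=> phi Cphi; have [_ /(_ phi Cphi)] := abscont_weak (ltW cd) AH.
  rewrite -ip_oint => ->; have Lphi : L2 `]c, d[ phi.
    exact: continuous_L2_oo (abscont_continuous (ltW cd) (C1c_abscont (ltW cd) Cphi)).
  by rewrite ipBl// -(opprK (ip _ g phi)) -wg// -(opprK (ip _ g' phi)) -wg'// subrr oppr0.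
have AK := abscont_add AH (abscont_cst c d (- k)).
have K0 : forall x, c <= x <= d -> (H \+ cst (- k)) x = 0.
  apply: (abscont_ae0 cd AK).
  apply: filterS Hk.
  by move=> x /= hx /hx ->; rewrite subrr.
have h0 : ae_eq mu `]c, d[%classic h (cst 0).
  apply: oint_eq0_ae; first exact: L2_L1_oo.
  move=> x cxd; have := K0 x cxd; have := K0 c; rewrite lexx (ltW cd) => /(_ isT).
  by rewrite /H /= oint_nil -/h => k0 xk; lra.
apply: filterS h0.
by move=> x /= hx /hx /eqP; rewrite subr_eq0 => /eqP.
Qed.

(** Subtracting from [v] a primitive of its weak derivative leaves a weakly
    constant function. *)
Lemma weak_abscont c d v g : c < d -> L2 `]c, d[ v -> weak_derivative `]c, d[ v g ->
  exists2 S, abscont c d S g & ae_eq mu `]c, d[%classic v S.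
Proof.
move=> cd Lv [Lg wg].
have mD : measurable (`]c, d[%classic : set R) by [].
have AG := abscont_primitive 0 Lg; set G := (fun x => _) in AG.
have LG := continuous_L2_oo (abscont_continuous (ltW cd) AG).
have [|k vk] := weakly_constant cd (L2_L1_oo (L2B mD Lv LG)).
  move=> phi Cphi; have [_ /(_ phi Cphi) wG] := abscont_weak (ltW cd) AG.
  rewrite -ip_oint ipBl//; first by rewrite wG wg// subrr.
  by case: Cphi => _ cphi _ _; apply: continuous_L2_oo; exact: continuous_subspaceT.
exists (G \+ cst k).
  have := abscont_add AG (abscont_cst c d k); apply: abscont_ae; first exact: L2_meas.
  by apply: aeW => x _ /=; rewrite addr0.
apply: filterS vk.
by move=> x /= hx /hx /eqP; rewrite subr_eq => /eqP ->; rewrite addrC.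
Qed.

Lemma weak_ae c d v v' g : L2 `]c, d[ v -> L2 `]c, d[ v' ->
  ae_eq mu `]c, d[%classic v v' ->
  weak_derivative `]c, d[ v g -> weak_derivative `]c, d[ v' g.
Proof.
move=> Lv Lv' vv [Lg wg]; split=> // phi Cphi; rewrite -wg//.
have Lphi : L2 `]c, d[ (derive1 phi).
  by case: Cphi => _ cphi _ _; apply: continuous_L2_oo; exact: continuous_subspaceT.
by apply: ae_eq_ip => //; [exact: ae_eq_sym|exact: ae_eq_refl].
Qed.

Lemma grad_weak D v g : weak_derivative D v g -> weak_derivative D v (grad D v).
Proof. by move=> wg; apply: (@xgetPex _ (cst 0) [set g | weak_derivative D v g]); exists g. Qed.

Lemma grad_ae c d v g : c < d -> weak_derivative `]c, d[ v g ->
  ae_eq mu `]c, d[%classic (grad `]c, d[ v) g.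
Proof. by move=> cd wg; apply: weak_unique cd (grad_weak wg) wg. Qed.

Lemma grad_L2 D v g : weak_derivative D v g -> L2 D (grad D v).
Proof. by move=> /grad_weak[]. Qed.

End weak_derivatives.

(** * The sharp Friedrichs inequality *)
Section friedrichs.
Context {R : realType}.
Implicit Types (f g G : R -> R) (c d m k x : R).
Local Notation mu := (@lebesgue_measure R).

(** Centring at the midpoint keeps the argument of the tangent inside
    [(-pi/2, pi/2)] on the whole closed interval when [k (d - c) < pi]. *)
Lemma abscont_tan c d k : c <= d -> 0 <= k -> k * (d - c) < pi ->
  let T := fun x => tan (k * (x - (c + d) / 2)) in
  abscont c d T (fun x => k * (1 + T x ^+ 2)).
Proof.
move=> cd k0 kpi T.
have cos0 x : c <= x <= d -> cos (k * (x - (c + d) / 2)) != 0.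
  by move=> /andP[cx xd]; rewrite gt_eqF// cos_gt0_pihalf//; apply/andP; split; nra.
have dT x : c <= x <= d -> is_derive x 1 T (k * (1 + T x ^+ 2)).
  move=> /cos0 cx.
  have dl : is_derive x (1 : R) (fun x => k * (x - (c + d) / 2)) k.
    by apply: is_derive_eq; rewrite /GRing.scale/=; ring.
  have := @is_derive1_comp R tan (fun x => k * (x - (c + d) / 2)) x _ _ (is_derive_tan cx) dl.
  move=> h; apply: (is_derive_eq h); rewrite mulrC; congr (_ * _).
  rewrite /T /tan; apply: (@mulIf _ (cos (k * (x - (c + d) / 2)) ^+ 2)).
    by rewrite expf_neq0.
  rewrite mulVf ?expf_neq0// mulrDl mul1r expr_div_n divfK ?expf_neq0//.
  by rewrite cos2Dsin2.
have cT : {within `[c, d], continuous T}.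
  apply: continuous_in_subspaceT => x; rewrite inE/= in_itv/= => /dT[dTx _].
  by apply: differentiable_continuous; exact/derivable1_diffP.
apply: abscont_derive => // x; apply: cvgM; first exact: cvg_cst.
by apply: cvgD; [exact: cvg_cst|apply: cvgM; exact: cT].
Qed.

(** With [T = tan (k (x - m))] one has [T' = k (1 + T^2)], whence the pointwise
    identity [(g + k G T)^2 = g^2 - k^2 G^2 + k (G^2 T)']. The last term
    integrates to zero as [G] vanishes at both ends. *)
Lemma friedrichs_lt c d k G g : c <= d -> abscont c d G g -> G c = 0 -> G d = 0 ->
  0 <= k -> k * (d - c) < pi -> k * nrm `]c, d[ G <= nrm `]c, d[ g.
Proof.
move=> cd AG Gc Gd k0 kpi; have AT := abscont_tan cd k0 kpi.
set T := (fun x => tan _) in AT.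
have cG := abscont_continuous cd AG; have cT := abscont_continuous cd AT.
have AGG := abscont_mul cd AG AG; have AGGT := abscont_mul cd AGG AT.
set q := (fun x => _ * T x + _) in AGGT.
have q0 : oint c d q = 0.
  have [_ /(_ d)] := AGGT; rewrite lexx cd => /(_ isT) /=.
  by rewrite Gc Gd !mul0r add0r.
have Lg : L2 `]c, d[ g by case: AG.
have LG := continuous_L2_oo cG.
have mD : measurable (`]c, d[%classic : set R) by [].
have LGT : L2 `]c, d[ (fun x => k * (G x * T x)).
  by apply: L2Z => //; apply: continuous_L2_oo => x; apply: cvgM; [exact: cG|exact: cT].
rewrite -(@ler_pXn2r _ 2) ?nnegrE ?mulr_ge0 ?nrm_ge0// exprMn !nrm_sqr -subr_ge0.
rewrite (_ : _ - _ = ip `]c, d[ (g \+ (fun x => k * (G x * T x)))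
                               (g \+ (fun x => k * (G x * T x)))) ?ip_ge0//.
have qi := abscont_L1 AGGT.
have ggi := L2_mul_L1 mD Lg Lg; have GGi := L2_mul_L1 mD LG LG.
rewrite -[LHS]addr0 -(mulr0 k) -q0 /ip -/(oint _ _ _) -/(oint _ _ _).
rewrite /oint -!L1_intZ// -L1_intB//; last exact: L1Z.
rewrite -L1_intD//; [|by apply: L1B => //; exact: L1Z|exact: L1Z].
by apply: eq_oint => x _; rewrite /q /=; ring.
Qed.

(** The limit [k -> pi / (d - c)] of [friedrichs_lt]. At the limit itself the
    tangent is singular at the endpoints, which is why the strict case is
    proved first. *)
Lemma friedrichs_sharp c d G g : c < d -> abscont c d G g -> G c = 0 -> G d = 0 ->
  nrm `]c, d[ G <= (d - c) / pi * nrm `]c, d[ g.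
Proof.
move=> cd AG Gc Gd; rewrite leNgt; apply/negP => lt.
have dc0 : 0 < d - c by rewrite subr_gt0.
have pi0 := pi_gt0 R.
have n0 := nrm_ge0 `]c, d[ g.
have nG : 0 < nrm `]c, d[ G.
  by apply: le_lt_trans lt; rewrite mulr_ge0// divr_ge0// ltW.
(* A rate k < pi / (d - c) with k |G| > |g|. *)
pose k := (nrm `]c, d[ g / nrm `]c, d[ G + pi / (d - c)) / 2.
have r0 : 0 <= nrm `]c, d[ g / nrm `]c, d[ G by rewrite divr_ge0 // ltW.
have p0 : 0 <= pi / (d - c) by rewrite divr_ge0// ltW.
have rp : nrm `]c, d[ g / nrm `]c, d[ G < pi / (d - c).
  rewrite ltr_pdivrMr// -(@ltr_pM2l _ ((d - c) / pi)) ?divr_gt0//.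
  rewrite [X in _ < X](_ : _ = nrm `]c, d[ G)//.
  have E (x y z : R) : 0 < x -> 0 < y -> x / y * (y / x * z) = z.
    by move=> x0 y0; field; rewrite (gt_eqF x0) (gt_eqF y0).
  exact: E.
have k0 : 0 <= k by rewrite /k divr_ge0// addr_ge0.
have kpi : k * (d - c) < pi.
  by rewrite -ltr_pdivlMr//; exact: (midf_lt rp).2.
have := friedrichs_lt (ltW cd) AG Gc Gd k0 kpi.
by rewrite leNgt -ltr_pdivrMr// => /negP; apply; exact: (midf_lt rp).1.
Qed.

End friedrichs.

(** * Piecewise polynomials *)
Section piecewise_polynomials.
Context {R : realType}.
Implicit Types (f g G H phi psi v w : R -> R) (c d m x y : R) (p q : {poly R}).
Local Notation mu := (@lebesgue_measure R).

Lemma ae_eq_cat c y d v w : ae_eq mu `]c, y[%classic v w -> ae_eq mu `]y, d[%classic v w ->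
  ae_eq mu `]c, d[%classic v w.
Proof.
move=> h1 h2.
have hy : {ae mu, forall x, x != y}.
  exists [set y]; split; [exact: measurable_set1|exact: lebesgue_measure_set1|].
  by move=> x /= /negP; rewrite negbK => /eqP.
apply: filterS3 h1 h2 hy => x /= h1 h2 xy; rewrite in_itv/= => /andP[cx xd].
move: xy; rewrite neq_lt => /orP[xy|yx].
  by apply: h1; rewrite in_itv/= cx.
by apply: h2; rewrite in_itv/= yx.
Qed.

Lemma ae_eq_oo c d c' d' v w : c <= c' -> d' <= d -> ae_eq mu `]c, d[%classic v w ->
  ae_eq mu `]c', d'[%classic v w.
Proof.
move=> cc dd; apply: filterS => x /= h xx; apply: h.
exact: subset_oo xx.
Qed.

Lemma eq_ae_eq (D : set R) v w : (forall x, D x -> v x = w x) -> ae_eq mu D v w.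
Proof. by move=> vw; apply: aeW => x /= /vw. Qed.

(** The bound is on the size, i.e. on the degree plus one, so that a
    derivative costs exactly one unit, down to size zero. *)
Definition poly_on (n : nat) c d v : Prop :=
  exists2 p : {poly R}, (size p <= n)%N & forall x, c < x < d -> v x = p.[x].

Lemma poly_on_nil n c d v : d <= c -> poly_on n c d v.
Proof.
move=> dc; exists 0; first by rewrite size_poly0.
by move=> x /andP[cx xd]; have := lt_trans cx xd; rewrite ltNge dc.
Qed.

Lemma poly_on_leq n n' c d v : (n <= n')%N -> poly_on n c d v -> poly_on n' c d v.
Proof. by move=> nn [p sp vp]; exists p => //; exact: leq_trans nn. Qed.

Lemma poly_on_cst c d k : poly_on 1 c d (cst k).
Proof. by exists k%:P; rewrite ?size_polyC_leq1// => x _; rewrite hornerC. Qed.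

Lemma poly_onD n c d v w : poly_on n c d v -> poly_on n c d w -> poly_on n c d (v \+ w).
Proof.
move=> [p sp vp] [q sq wq]; exists (p + q).
  by rewrite (leq_trans (size_polyD _ _))// geq_max sp.
by move=> x xcd /=; rewrite hornerD vp// wq.
Qed.

Lemma poly_onZ n c d k v : poly_on n c d v -> poly_on n c d (fun x => k * v x).
Proof.
move=> [p sp vp]; exists (k *: p); first by rewrite (leq_trans (size_scale_leq _ _)).
by move=> x xcd /=; rewrite hornerZ vp.
Qed.

Lemma poly_onM n n' c d v w : poly_on n c d v -> poly_on n' c d w ->
  poly_on (n + n').-1 c d (v \* w).
Proof.
move=> [p sp vp] [q sq wq]; exists (p * q).
  by rewrite (leq_trans (size_polyMleq _ _))// -!subn1 leq_sub2r// leq_add.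
by move=> x xcd /=; rewrite hornerM vp// wq.
Qed.

Lemma poly_on_L2 n c d v : poly_on n c d v -> L2 `]c, d[ v.
Proof.
move=> [p _ vp]; have Lp : L2 `]c, d[ (horner p).
  by apply: continuous_L2_oo; apply: continuous_subspaceT; exact: continuous_horner.
have E : {in (`]c, d[%classic : set R), horner p =1 v}.
  by move=> x; rewrite mem_oo => /vp.
have mD : measurable (`]c, d[%classic : set R) by [].
move: Lp => /(L2P _ mD)[mw iw]; apply/(L2P _ mD); split.
  exact: eq_measurable_fun mw.
by apply: eq_L1 iw => // x /E <-.
Qed.

(** On [(c, d)] both [g] and the formal derivative of the polynomial are weak
    derivatives of the same function. *)
Lemma abscont_poly_on n c d v S g : c <= d -> poly_on n c d v ->
  ae_eq mu `]c, d[%classic v S -> abscont c d S g ->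
  exists2 p : {poly R}, (size p <= n.-1)%N & ae_eq mu `]c, d[%classic g (horner p).
Proof.
rewrite le_eqVlt => /predU1P[<- _ _ _|cd [p sp vp] vS AS].
  exists 0; first by rewrite size_poly0.
  by apply: eq_ae_eq => x /=; rewrite in_itv/= => /andP[/lt_trans h /h]; rewrite ltxx.
exists p^`().
  have [->|p0] := eqVneq p 0; first by rewrite deriv0 size_poly0.
  by rewrite -ltnS (leq_trans (lt_size_deriv p0))// (leq_trans sp)// leqSpred.
have Ap : abscont c d (horner p) (horner p^`()).
  refine (abscont_derive (ltW cd) (fun x _ => is_derive_poly p x) _).
  by apply: continuous_subspaceT; exact: continuous_horner.
apply: (weak_unique cd (abscont_weak (ltW cd) AS)).
have Sp : ae_eq mu `]c, d[%classic (horner p) S.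
  apply: filterS vS => x /= h xcd; rewrite -h// vp//.
apply: weak_ae Sp (abscont_weak (ltW cd) Ap).
  by apply: continuous_L2_oo; apply: continuous_subspaceT; exact: continuous_horner.
exact: continuous_L2_oo (abscont_continuous (ltW cd) AS).
Qed.

Lemma abscont_affine c d G g k0 k1 : c <= d ->
  (forall x, c <= x <= d -> G x = k0 + k1 * x) -> (forall x, c < x < d -> g x = k1) ->
  abscont c d G g.
Proof.
move=> cd GE gE; split.
  apply: (@poly_on_L2 1); exists k1%:P; rewrite ?size_polyC_leq1//.
  by move=> x /gE ->; rewrite hornerC.
move=> x /[dup] cxd /andP[cx xd]; rewrite !GE ?lexx//.
rewrite (@eq_oint _ c x g (cst k1)) ?oint_cst//; first by ring.
by move=> t /andP[ct tx]; rewrite gE// ct (lt_le_trans tx).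
Qed.

Lemma abscont_degenerate c d G g : d <= c -> c <= d -> abscont c d G g.
Proof.
move=> dc cd; have -> : d = c by apply/le_anti; rewrite dc cd.
split; first by apply: (@poly_on_L2 0); exact: poly_on_nil.
by move=> x /le_anti <-; rewrite oint_nil addr0.
Qed.

(** A vertex patch has at most two elements, separated by its vertex; at a
    boundary vertex one of the two intervals is empty. This covers all
    vertices without a case distinction. *)
Definition ppoly2 (n : nat) c y d v : Prop := poly_on n c y v /\ poly_on n y d v.

Lemma ppoly2_L2 n c y d v : ppoly2 n c y d v -> L2 `]c, d[ v.
Proof. by move=> [h1 h2]; apply: L2_cat; [exact: poly_on_L2 h1|exact: poly_on_L2 h2]. Qed.

(** Membership in [H^1] excludes a jump at [y]: the weak derivative is then the
    elementwise derivative, which is again piecewise polynomial. *)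
Lemma H1_ppoly2 n c y d v : c < d -> c <= y -> y <= d -> ppoly2 n c y d v -> H1 `]c, d[ v ->
  exists S, exists g, [/\ abscont c d S g, ppoly2 n.-1 c y d g &
    ae_eq mu `]c, d[%classic v S].
Proof.
move=> cd cy yd [v1 v2] [Lv [g0 wg0]].
have [S AS vS] := weak_abscont cd Lv wg0.
have [p1 s1 g1] := abscont_poly_on cy v1 (ae_eq_oo (lexx c) yd vS)
  (abscont_sub (lexx c) cy yd AS).
have [p2 s2 g2] := abscont_poly_on yd v2 (ae_eq_oo cy (lexx d) vS)
  (abscont_sub cy yd (lexx d) AS).
pose g x := if x < y then p1.[x] else p2.[x].
have pg : ppoly2 n.-1 c y d g.
  split; [exists p1|exists p2] => // x /andP[cx xd]; rewrite /g ?xd//.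
  by rewrite ltNge (ltW cx).
exists S, g; split => //.
apply: abscont_ae AS; first exact: L2_meas (ppoly2_L2 pg).
apply: (@ae_eq_cat _ y).
  apply: filterS g1 => x /= h xcy; rewrite h// /g.
  by move: xcy; rewrite in_itv/= => /andP[_ ->].
apply: filterS g2 => x /= h xyd; rewrite h// /g.
by move: xyd; rewrite in_itv/= => /andP[yx _]; rewrite ltNge (ltW yx).
Qed.

End piecewise_polynomials.

(** * Geometry of the mesh and hat functions *)
Section mesh_facts.
Context {R : realType} {l r : R} (M : mesh l r).
Implicit Types (a : vertex M) (K : element M) (x : R).
Local Notation mu := (@lebesgue_measure R).
Local Notation nd := (node M).

Lemma node_le i j : (i <= j)%N -> (j <= ncell M)%N -> nd i <= nd j.
Proof.
elim: j => [|j IH]; first by rewrite leqn0 => /eqP ->.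
rewrite leq_eqVlt => /predU1P[->//|]; rewrite ltnS => ij jn.
by rewrite (le_trans (IH ij (ltnW jn)))// ltW// node_lt.
Qed.

Lemma node_ltn i j : (i < j)%N -> (j <= ncell M)%N -> nd i < nd j.
Proof.
move=> ij jn; apply: (@lt_le_trans _ _ (nd i.+1)); last exact: node_le.
by apply: node_lt; exact: leq_trans jn.
Qed.

Lemma vertex_le a : (a <= ncell M)%N. Proof. by rewrite -ltnS. Qed.

Lemma omega_l_ge a : l <= omega_l a.
Proof.
apply: (@le_trans _ _ (nd 0%N)); first by rewrite node_first.
by apply: node_le => //; exact: leq_trans (leq_pred _) (vertex_le a).
Qed.

Lemma omega_r_le a : omega_r a <= r.
Proof.
apply: (@le_trans _ _ (nd (ncell M))); last by rewrite node_last.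
by apply: node_le => //; exact: geq_minr.
Qed.

Lemma omega_l_node a : omega_l a <= nd a.
Proof. by apply: node_le; [exact: leq_pred|exact: vertex_le]. Qed.

Lemma node_omega_r a : nd a <= omega_r a.
Proof. by apply: node_le; [rewrite leq_min leqnSn vertex_le|exact: geq_minr]. Qed.

Lemma omega_l_lt a : (0 < a)%N -> omega_l a < nd a.
Proof. by move=> a0; apply: node_ltn; [rewrite prednK|exact: vertex_le]. Qed.

Lemma lt_omega_r a : (a < ncell M)%N -> nd a < omega_r a.
Proof. by move=> an; apply: node_ltn; [rewrite leq_min ltnSn|exact: geq_minr]. Qed.

Lemma omega_l0 a : a = 0%N :> nat -> omega_l a = nd a.
Proof. by rewrite /omega_l => ->. Qed.

Lemma omega_rn a : a = ncell M :> nat -> omega_r a = nd a.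
Proof. by rewrite /omega_r => ->; rewrite (minn_idPr _)// leqnSn. Qed.

Lemma omega_lt a : omega_l a < omega_r a.
Proof.
have [a0|a0] := posnP a.
  by rewrite omega_l0// lt_omega_r// a0 ncell_gt0.
exact: lt_le_trans (omega_l_lt a0) (node_omega_r a).
Qed.

Lemma omega_l_eq a : omega_l a = nd a -> nd a = l.
Proof.
have [a0 _|/omega_l_lt /lt_eqF h /eqP] := posnP a; last by rewrite h.
by rewrite a0 node_first.
Qed.

Lemma omega_r_eq a : nd a = omega_r a -> nd a = r.
Proof.
have [an|/lt_omega_r /lt_eqF h /eqP] := leqP (ncell M) a; last by rewrite h.
by have -> : (a : nat) = ncell M; [apply/eqP; rewrite eqn_leq vertex_le|rewrite node_last].
Qed.

Lemma node_eq_l a : nd a = l -> omega_l a = nd a.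
Proof.
have [/omega_l0//|a0] := posnP a.
by have := node_ltn a0 (vertex_le a); rewrite node_first => /gt_eqF h /eqP; rewrite h.
Qed.

Lemma node_eq_r a : nd a = r -> omega_r a = nd a.
Proof.
have [an _|an] := leqP (ncell M) a.
  by rewrite omega_rn//; apply/eqP; rewrite eqn_leq vertex_le.
by have := node_ltn an (leqnn _); rewrite node_last => /lt_eqF h /eqP; rewrite h.
Qed.

Lemma cell_left K a : a = K.+1 :> nat -> cell K = `]omega_l a, nd a[%classic.
Proof. by rewrite /cell /omega_l => ->. Qed.

Lemma cell_right K a : a = K :> nat -> cell K = `]nd a, omega_r a[%classic.
Proof. by rewrite /cell /omega_r => ->; rewrite (minn_idPl _). Qed.

Lemma ppoly_ppoly2 n a v :
  ppoly n (is_vertex_of a) v <-> ppoly2 n.+1 (omega_l a) (nd a) (omega_r a) v.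
Proof.
split=> [pv|[v1 v2] K /orP[]/eqP aK].
- split.
    have [a0|a0] := posnP a; first by apply: poly_on_nil; rewrite omega_l0.
    have Kn : (a.-1 < ncell M)%N by rewrite prednK ?vertex_le.
    have aK : a = (Ordinal Kn).+1 :> nat by rewrite /= prednK.
    have [|p sp vp] := pv (Ordinal Kn); first by rewrite /is_vertex_of -aK eqxx orbT.
    by exists p => // x xc; apply: vp; rewrite (cell_left aK)/= in_itv.
  have [an|an] := leqP (ncell M) a.
    apply: poly_on_nil; rewrite omega_rn//; apply/eqP.
    by rewrite eqn_leq vertex_le.
  have [|p sp vp] := pv (Ordinal an); first by rewrite /is_vertex_of eqxx.
  by exists p => // x xc; apply: vp; rewrite (@cell_right _ a)//= in_itv.
- have [p sp vp] := v2; exists p => // x.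
  by rewrite (cell_right aK)/= in_itv/=; exact: vp.
- have [p sp vp] := v1; exists p => // x.
  by rewrite (cell_left aK)/= in_itv/=; exact: vp.
Qed.

(** The elementwise slope of the hat function, extended by zero. *)
Definition dhat a (x : R) : R :=
  if x < nd a then
    if omega_l a < x then (nd a - omega_l a)^-1 else 0
  else
    if nd a < x < omega_r a then - (omega_r a - nd a)^-1 else 0.

Lemma hat_left a x : omega_l a <= x <= nd a -> omega_l a < nd a ->
  hat a x = (x - omega_l a) / (nd a - omega_l a).
Proof.
move=> /andP[cx xy] cy; rewrite /hat.
have [->|xny] := eqVneq x (nd a); first by rewrite divff// subr_eq0 gt_eqF.
have {}xy : x < nd a by rewrite lt_neqAle xny.
have [->|xnc] := eqVneq x (omega_l a).
  by rewrite ltxx/= subrr mul0r ltNge omega_l_node/=.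
by rewrite lt_neqAle eq_sym xnc cx xy.
Qed.

Lemma hat_right a x : nd a <= x <= omega_r a -> nd a < omega_r a ->
  hat a x = (omega_r a - x) / (omega_r a - nd a).
Proof.
move=> /andP[yx xd] yd; rewrite /hat.
have [->|xny] := eqVneq x (nd a); first by rewrite divff// subr_eq0 gt_eqF.
have {}yx : nd a < x by rewrite lt_neqAle eq_sym xny.
rewrite [x < nd a]ltNge (ltW yx) andbF yx/=.
have [->|xnd] := eqVneq x (omega_r a); first by rewrite ltxx subrr mul0r.
by rewrite lt_neqAle xnd xd.
Qed.

Lemma hat_out a x : x != nd a -> ~~ (omega_l a < x < omega_r a) -> hat a x = 0.
Proof.
move=> xy; rewrite /hat (negbTE xy) negb_and -!leNgt => /orP[xc|dx].
  rewrite [omega_l a < x]ltNge xc/= [nd a < x]ltNge (le_trans xc)//.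
  exact: omega_l_node.
rewrite [x < omega_r a]ltNge dx andbF [x < nd a]ltNge (le_trans _ dx) ?andbF//.
exact: node_omega_r.
Qed.

Lemma hat_abscont a : abscont l r (hat a) (dhat a).
Proof.
have lc := omega_l_ge a; have dr := omega_r_le a.
have cy := omega_l_node a; have yd := node_omega_r a.
have cr : omega_l a <= r by rewrite (le_trans cy)// (le_trans yd).
apply: (@abscont_cat _ _ (omega_l a)) => //.
  have [cl|lc'] := leP (omega_l a) l; first exact: abscont_degenerate.
  apply: (@abscont_affine _ _ _ _ _ 0 0) => [|x /andP[lx xc]|x /andP[lx xc]]; first exact: ltW.
    rewrite mul0r addr0 hat_out//; last by rewrite [_ < x]ltNge xc.
    apply/eqP => xy; move: lc'; suff -> : omega_l a = l by rewrite ltxx.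
    have e : omega_l a = nd a by apply/le_anti; rewrite cy -xy xc.
    by rewrite e (omega_l_eq e).
  by rewrite /dhat (lt_le_trans xc cy) ltNge (ltW xc).
apply: (@abscont_cat _ _ (nd a)) => //; first exact: le_trans dr.
  have [yc|lt] := leP (nd a) (omega_l a); first exact: abscont_degenerate.
  apply: (@abscont_affine _ _ _ _ _ (- omega_l a / (nd a - omega_l a)) (nd a - omega_l a)^-1) => // x.
    by move=> xc; rewrite hat_left//; ring.
  by move=> /andP[cx xy]; rewrite /dhat xy cx.
apply: (@abscont_cat _ _ (omega_r a)) => //.
  have [dy|lt] := leP (omega_r a) (nd a); first exact: abscont_degenerate.
  apply: (@abscont_affine _ _ _ _ _ (omega_r a / (omega_r a - nd a)) (- (omega_r a - nd a)^-1)) => // x.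
    by move=> xc; rewrite hat_right//; ring.
  by move=> /andP[yx xd]; rewrite /dhat yx xd [x < _]ltNge (ltW yx).
have [rd|lt] := leP r (omega_r a); first exact: abscont_degenerate.
apply: (@abscont_affine _ _ _ _ _ 0 0) => [|x /andP[dx xr]|x /andP[dx xr]]; first exact: ltW.
  rewrite mul0r addr0 hat_out//; last by rewrite [x < _]ltNge dx andbF.
  apply/eqP => xy; move: lt; suff -> : omega_r a = r by rewrite ltxx.
  have e : nd a = omega_r a by apply/le_anti; rewrite yd -xy dx.
  by rewrite -e (omega_r_eq e).
rewrite /dhat [x < nd a]ltNge (le_trans yd (ltW dx))/=.
by rewrite [x < omega_r a]ltNge (ltW dx) andbF.
Qed.

Lemma hat_ge0_le1 a x : 0 <= hat a x <= 1.
Proof.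
have [->|xy] := eqVneq x (nd a); first by rewrite /hat eqxx ler01 lexx.
have [/andP[cx xd]|out] := boolP (omega_l a < x < omega_r a); last first.
  by rewrite hat_out// lexx ler01.
move: xy; rewrite neq_lt => /orP[xy|yx].
  have cy := lt_trans cx xy.
  rewrite hat_left ?(ltW cx) ?(ltW xy)//.
  by rewrite divr_ge0 ?subr_ge0 ?(ltW cx) ?(ltW cy)//= ler_pdivrMr ?subr_gt0// mul1r lerD2r ltW.
have yd := lt_trans yx xd.
rewrite hat_right ?(ltW xd) ?(ltW yx)//.
by rewrite divr_ge0 ?subr_ge0 ?(ltW xd) ?(ltW yd)//= ler_pdivrMr ?subr_gt0// mul1r lerD2l lerN2 ltW.
Qed.

Lemma hat_poly2 a : ppoly2 2 (omega_l a) (nd a) (omega_r a) (hat a).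
Proof.
split.
  exists ((nd a - omega_l a)^-1 *: ('X - (omega_l a)%:P)).
    by rewrite (leq_trans (size_scale_leq _ _))// size_XsubC.
  move=> x /andP[cx xy]; rewrite hat_left ?(ltW cx) ?(ltW xy)//; last exact: lt_trans xy.
  by rewrite hornerZ hornerXsubC mulrC.
exists (- (omega_r a - nd a)^-1 *: ('X - (omega_r a)%:P)).
  by rewrite (leq_trans (size_scale_leq _ _))// size_XsubC.
move=> x /andP[yx xd]; rewrite hat_right ?(ltW yx) ?(ltW xd)//; last exact: lt_trans xd.
by rewrite hornerZ hornerXsubC; ring.
Qed.

Lemma dhat_poly2 a : ppoly2 1 (omega_l a) (nd a) (omega_r a) (dhat a).
Proof.
split.
  exists (nd a - omega_l a)^-1%:P; first exact: size_polyC_leq1.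
  by move=> x /andP[cx xy]; rewrite /dhat xy cx hornerC.
exists (- (omega_r a - nd a)^-1)%:P; first exact: size_polyC_leq1.
by move=> x /andP[yx xd]; rewrite /dhat [x < _]ltNge (ltW yx)/= yx xd hornerC.
Qed.

Lemma dhat_out a x : ~~ (omega_l a < x < omega_r a) -> dhat a x = 0.
Proof.
rewrite negb_and /dhat => /orP[/negbTE cx|/negbTE xd].
  rewrite cx; case: ifP => // _; case: ifP => // /andP[yx _].
  by move: cx; rewrite (le_lt_trans (omega_l_node a) yx).
rewrite xd andbF; case: ifP => // xy.
by move: xd; rewrite (lt_le_trans xy (node_omega_r a)).
Qed.

Lemma dhat_bounded a x : `|dhat a x| <= `|(nd a - omega_l a)^-1| + `|(omega_r a - nd a)^-1|.
Proof.
rewrite /dhat; case: ifP => _; case: ifP => _; rewrite ?normr0 ?normrN ?addr_ge0//.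
  by rewrite lerDl.
by rewrite lerDr.
Qed.

Lemma hat_cell_out K a x : cell K x -> ~~ is_vertex_of a K -> hat a x = 0.
Proof.
rewrite /cell/= in_itv/= negb_or => /andP[Kx xK] /andP[aK aK1].
have Kn : (K < ncell M)%N by [].
have [lt|gt|/eqP e] := ltngtP (a : nat) K; last by rewrite (negbTE aK) in e.
  have aK' : omega_r a <= nd K.
    by apply: node_le; [rewrite (leq_trans (geq_minl _ _))|exact: ltnW].
  rewrite hat_out//.
    by rewrite gt_eqF// (le_lt_trans _ Kx)// (le_trans _ aK')// node_omega_r.
  by rewrite [x < _]ltNge (le_trans aK' (ltW Kx)) andbF.
have {}gt : (K.+1 < a)%N by rewrite ltn_neqAle eq_sym aK1.
have Ka : nd K.+1 <= omega_l a.
  by apply: node_le; [rewrite -ltnS prednK// (ltn_trans _ gt)|rewrite (leq_trans (leq_pred _)) ?vertex_le].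
rewrite hat_out//.
  by rewrite lt_eqF// (lt_le_trans xK)// (le_trans Ka)// omega_l_node.
by rewrite [_ < x]ltNge (le_trans (ltW xK) Ka).
Qed.

Definition vleft K : vertex M := inord K.
Definition vright K : vertex M := inord K.+1.

Lemma vleftE K : vleft K = K :> nat.
Proof. by rewrite /vleft inordK// ltnS ltnW. Qed.

Lemma vrightE K : vright K = K.+1 :> nat.
Proof. by rewrite /vright inordK// ltnS. Qed.

Lemma sum_vertices K (F : vertex M -> R) :
  \sum_(a : vertex M | is_vertex_of a K) F a = F (vleft K) + F (vright K).
Proof.
have lr : vright K != vleft K.
  by apply/eqP => /(congr1 val)/eqP; rewrite /= vleftE vrightE -[X in _ == X]addn0 -addn1 eqn_add2l.
rewrite (bigD1 (vleft K))/=; last by rewrite /is_vertex_of vleftE eqxx.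
rewrite (bigD1 (vright K))/=; last by rewrite /is_vertex_of vrightE eqxx orbT lr.
rewrite big_pred0 ?addr0// => a; apply/negbTE; rewrite !negb_and !negbK.
rewrite -!val_eqE/= vleftE vrightE.
by rewrite /is_vertex_of; case: eqP => //= _; case: eqP.
Qed.

Lemma hat_partition K x : cell K x -> hat (vleft K) x + hat (vright K) x = 1.
Proof.
move=> xK; have := xK; rewrite /cell/= in_itv/= => /andP[Kx xK1].
have lE : nd (vleft K) = nd K by rewrite vleftE.
have rE : nd (vright K) = nd K.+1 by rewrite vrightE.
have olE : omega_l (vright K) = nd K by rewrite /omega_l vrightE.
have orE : omega_r (vleft K) = nd K.+1 by rewrite /omega_r vleftE (minn_idPl _).
have KK : nd K < nd K.+1 by exact: lt_trans xK1.
rewrite hat_right ?hat_left ?lE ?rE ?olE ?orE ?(ltW Kx) ?(ltW xK1)//.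
by rewrite -mulrDl addrA subrK divff// subr_eq0 gt_eqF.
Qed.

Lemma cell_omega K a : is_vertex_of a K -> cell K `<=` omega a.
Proof.
move=> /orP[]/eqP aK x.
  rewrite (cell_right aK) /omega/= !in_itv/= => /andP[yx ->].
  by rewrite (le_lt_trans (omega_l_node a) yx).
rewrite (cell_left aK) /omega/= !in_itv/= => /andP[-> xy].
by rewrite (lt_le_trans xy (node_omega_r a)).
Qed.

End mesh_facts.

(** * Essential bounds and absorption *)
Section auxiliary.
Context {R : realType}.
Implicit Types (f g u v w : R -> R) (c d : R).
Local Notation mu := (@lebesgue_measure R).

Lemma ae_imp (P Q : R -> Prop) : (forall x, P x -> Q x) ->
  {ae mu, forall x, P x} -> {ae mu, forall x, Q x}.
Proof. move=> PQ; exact: (@filterS _ _ (ae_filter_ringOfSetsType mu) _ _ PQ). Qed.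

(** Some bound [B] must be known beforehand: [nrm_oo] is the real part of an
    extended real, and would be a junk value for an unbounded function. *)
Lemma nrm_oo_ae c d v (B : R) : measurable_fun `]c, d[ v ->
  {ae mu, forall x, x \in `]c, d[ -> `|v x| <= B} -> 0 <= B ->
  {ae mu, forall x, x \in `]c, d[ -> `|v x| <= nrm_oo `]c, d[ v}.
Proof.
move=> mv vB B0; pose h := abse \o (EFin \o (v \_ `]c, d[)).
have muT : (0 < mu [set: R])%E by rewrite -set_itvNyy lebesgue_measure_itv/= ltry.
have hE : nrm_oo `]c, d[ v = fine (ess_sup mu h).
  by rewrite /nrm_oo unlock muT.
have hB : (ess_sup mu h <= B%:E)%E.
  apply/ess_supP; refine (ae_imp _ vB) => x /= {}vB.
  rewrite /h /= lee_fin patchE mem_oo; case: ifP => [xcd|_]; last by rewrite normr0.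
  by apply: vB; rewrite in_itv.
have h0 : (0 <= ess_sup mu h)%E.
  by apply: ess_sup_gee => //; apply: aeW => x /=; rewrite /h /= lee_fin.
have hfin : ess_sup mu h \is a fin_num.
  by rewrite ge0_fin_numE// (le_lt_trans hB) ?ltry.
refine (ae_imp _ (ess_sup_ge mu h)) => x /= + xcd.
rewrite hE -[X in (_ <= X)%E](fineK hfin) /h /= lee_fin patchE mem_oo.
by move: xcd; rewrite in_itv/= => ->.
Qed.

Lemma le_nrm_ae c d v w (N : R) : 0 <= N -> L2 `]c, d[ v -> L2 `]c, d[ w ->
  {ae mu, forall x, x \in `]c, d[ -> `|v x| <= N * `|w x|} ->
  nrm `]c, d[ v <= N * nrm `]c, d[ w.
Proof.
move=> N0 Lv Lw vw; have mD : measurable (`]c, d[%classic : set R) by [].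
(* Modified on a null set so that the bound holds everywhere. *)
pose v' x := if `|v x| <= N * `|w x| then v x else 0.
have mv := L2_meas mD Lv; have mw := L2_meas mD Lw.
have mv' : measurable_fun `]c, d[ v'.
  have mb : measurable_fun `]c, d[ (fun x => `|v x| <= N * `|w x|).
    apply: measurable_fun_ler; first exact: measurableT_comp.
    by apply: measurable_funM => //; exact: measurableT_comp.
  by apply: measurable_fun_if => //; exact: measurable_funS mv.
have vv' : ae_eq mu `]c, d[%classic v v'.
  by refine (ae_imp _ vw) => x /= h xcd; rewrite /v' h.
have Lv' := L2_ae mD mv' vv' Lv.
rewrite (ae_eq_nrm mD Lv Lv' vv') -[N in N * _](ger0_norm N0) -nrmZ//.
apply: le_nrm => //; first exact: L2Z.
move=> x xcd; rewrite /v' normrM (ger0_norm N0); case: ifP => // _.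
by rewrite normr0 mulr_ge0.
Qed.

Lemma ip_subdomain (D E : set R) g h : D `<=` E -> (forall x, E x -> ~ D x -> h x = 0) ->
  ip E g h = ip D g h.
Proof.
move=> DE h0; rewrite /ip Rintegral_mkcond [RHS]Rintegral_mkcond.
congr Rintegral; apply/funext => x; rewrite !patchE.
have [xD|xD] := boolP (x \in D).
  by rewrite ifT// inE; apply: DE; rewrite inE in xD.
case: ifPn => // /set_mem xE; rewrite h0 ?mulr0//.
by move=> /mem_set; rewrite (negbTE xD).
Qed.

(** The last step of the duality argument: divide a bound of [B n^2] by
    [B n]. *)
Lemma absorb_norm (n m N h C q B pb : R) : 0 <= n -> 0 <= m -> 0 <= N -> 0 <= h ->
  0 <= C -> 0 <= q -> 0 < B -> 0 < pb ->
  B * n ^+ 2 <= B * (m * n) + B * (N * m * (h * C * n)) + h / pb * q * n ->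
  n <= (1 + C * h * N) * m + h / (pb * B) * q.
Proof.
move=> n0 m0 N0 h0 C0 q0 B0 pb0 H.
move: n0; rewrite le_eqVlt => /predU1P[<-|n0].
  by rewrite addr_ge0// !mulr_ge0// ?invr_ge0 ?mulr_ge0 ?addr_ge0 ?mulr_ge0// ltW.
rewrite -(@ler_pM2l _ (B * n)) ?mulr_gt0//.
rewrite (_ : B * n * n = B * n ^+ 2); last by ring.
apply: (le_trans H); rewrite le_eqVlt; apply/orP; left; apply/eqP.
by field; rewrite !gt_eqF.
Qed.

Lemma outflow_unique (b l r e e' : R) : l < r -> outflow b l r e -> outflow b l r e' -> e = e'.
Proof.
move=> lr [ee be] [ee' be']; move: ee be ee' be'; rewrite /normal.
move=> [->|->]; move=> + [->|->]; rewrite ?eqxx ?(gt_eqF lr) ?mulr1 ?mulrN1 ?oppr_gt0 => // h1 h2.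
  by have := lt_trans h1 h2; rewrite ltxx.
by have := lt_trans h1 h2; rewrite ltxx.
Qed.

End auxiliary.

(** * Functions on a vertex patch *)
Section vertex_patch.
Context {R : realType} {l r : R} (M : mesh l r) (a : vertex M).
Implicit Types (f g v w : R -> R).
Local Notation mu := (@lebesgue_measure R).
Local Notation c := (omega_l a).
Local Notation d := (omega_r a).
Local Notation y := (node M a).
Local Notation D := (`]omega_l a, omega_r a[%classic).

Let mD : measurable (D : set R). Proof. by []. Qed.
Let cd : c < d. Proof. exact: omega_lt. Qed.

Lemma hat_abscont_omega : abscont c d (hat a) (dhat a).
Proof.
apply: abscont_sub (hat_abscont a); first exact: omega_l_ge.
  exact: ltW.
exact: omega_r_le.
Qed.

Lemma grad_hat : ae_eq mu D (grad D (hat a)) (dhat a).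
Proof. exact: grad_ae cd (abscont_weak (ltW cd) hat_abscont_omega). Qed.

Lemma hatM_L2 v : L2 D v -> L2 D (fun x => hat a x * v x).
Proof.
apply: (@L2_mul_bounded _ _ _ _ 1) => //.
  exact: continuous_measurable_oo (abscont_continuous (ltW cd) hat_abscont_omega).
by move=> x _; have /andP[h0 h1] := hat_ge0_le1 a x; rewrite ger0_norm.
Qed.

Lemma dhatM_L2 v : L2 D v -> L2 D (fun x => dhat a x * v x).
Proof.
move=> Lv; apply: L2_mul_bounded Lv => //; last by move=> x _; exact: dhat_bounded.
by case: hat_abscont_omega => /(L2_meas mD).
Qed.

Lemma dhat_le_nrm_oo :
  {ae mu, forall x, x \in `]c, d[ -> `|dhat a x| <= nrm_oo D (grad D (hat a))}.
Proof.
have wh := abscont_weak (ltW cd) hat_abscont_omega.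
have Lg := grad_L2 wh.
have := @nrm_oo_ae _ c d (grad D (hat a)) _ (L2_meas mD Lg) _ _.
move=> /(_ (`|(y - c)^-1| + `|(d - y)^-1|)) H.
have {}H := H _ (addr_ge0 (normr_ge0 _) (normr_ge0 _)).
apply: filterS2 grad_hat (H _) => [x /= gh hN xcd|]; first by rewrite -gh// hN.
by apply: filterS grad_hat => x /= gh xcd; rewrite gh// dhat_bounded.
Qed.

Lemma nrm_oo_ge0 : 0 <= nrm_oo D (grad D (hat a)).
Proof.
rewrite /nrm_oo unlock; case: ifP => // h; apply: fine_ge0.
by apply: ess_sup_gee => //; apply: aeW => x /=; rewrite lee_fin.
Qed.

(** Here [T] is the continuous representative of [hat * v] and [e] its
    derivative. Since [hat] is piecewise affine, [e] has the same degree as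
    [v], so that it can be compared with the data by testing with piecewise
    polynomials of that degree. The last clause gives the values of [T] at the ends of the patch. *)
Lemma hatM_derivative n v : ppoly n (is_vertex_of a) v -> H1 D v ->
  exists T e, [/\ abscont c d T e, ppoly n (is_vertex_of a) e,
    ae_eq mu D T (hat a \* v), ae_eq mu D (grad D (hat a \* v)) e &
    forall x, hat a x = 0 -> T x = 0].
Proof.
move=> /ppoly_ppoly2 pv H1v.
have [S [g [AS pg vS]]] := H1_ppoly2 cd (omega_l_node a) (node_omega_r a) pv H1v.
pose e := (dhat a \* v) \+ (hat a \* g).
have Lv := ppoly2_L2 pv.
have pe : ppoly2 n.+1 c y d e.
  case: pv pg (hat_poly2 a) (dhat_poly2 a) => [v1 v2] [g1 g2] [h1 h2] [d1 d2].
  have P c' d' : poly_on n.+1 c' d' v -> poly_on n c' d' g -> poly_on 2 c' d' (hat a) ->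
      poly_on 1 c' d' (dhat a) -> poly_on n.+1 c' d' e.
    move=> hv hg hh hd; apply: poly_onD.
      exact: poly_onM hd hv.
    exact: poly_onM hh hg.
  by split; apply: P.
have Le := ppoly2_L2 pe.
have AT : abscont c d (hat a \* S) e.
  apply: abscont_ae (abscont_mul (ltW cd) hat_abscont_omega AS); first exact: L2_meas Le.
  by apply: filterS vS => x /= h xD; rewrite /e/= h.
have Tv : ae_eq mu D (hat a \* S) (hat a \* v).
  by apply: filterS vS => x /= h xD; rewrite h.
exists (hat a \* S), e; split => //; first exact/ppoly_ppoly2.
  apply: grad_ae => //; apply: weak_ae Tv (abscont_weak (ltW cd) AT).
    exact: continuous_L2_oo (abscont_continuous (ltW cd) AT).
  exact: hatM_L2.
by move=> x /= ->; rewrite mul0r.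
Qed.

(** The difference of two candidates is itself piecewise polynomial and
    orthogonal to both residuals, hence to itself. This identifies the
    projection without proving separately that it exists. *)
Lemma nrm_L2proj n g p : L2 D g -> ppoly n (is_vertex_of a) p ->
  (forall q, ppoly n (is_vertex_of a) q -> ip D (g \- p) q = 0) ->
  nrm D (g \- L2proj D (ppoly n (is_vertex_of a)) g) = nrm D (g \- p).
Proof.
move=> Lg pp orth.
have [] : [set p | ppoly n (is_vertex_of a) p /\
    forall q, ppoly n (is_vertex_of a) q -> ip D (g \- p) q = 0]
    (L2proj D (ppoly n (is_vertex_of a)) g).
  by apply: xgetPex; exists p.
set p' := L2proj _ _ _ => pp' orth'.
have Lp : L2 D p by apply: ppoly2_L2 ((ppoly_ppoly2 _ _ _).1 pp).
have Lp' : L2 D p' by apply: ppoly2_L2 ((ppoly_ppoly2 _ _ _).1 pp').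
have pd : ppoly n (is_vertex_of a) (p' \- p).
  move: pp pp' => /ppoly_ppoly2[p1 p2] /ppoly_ppoly2[p1' p2']; apply/ppoly_ppoly2.
  have E : p' \- p = p' \+ (fun x => (-1) * p x) by apply/funext => x /=; rewrite mulN1r.
  by rewrite E; split; apply: poly_onD => //; exact: poly_onZ.
have := orth _ pd; have := orth' _ pd; have LB := L2B mD Lp' Lp.
have LgP := L2B mD Lg Lp; have LgP' := L2B mD Lg Lp'.
move=> h' h.
have : ip D (p' \- p) (p' \- p) = 0.
  rewrite -[RHS](subrr 0) -[X in X - _]h -[X in _ - X]h' -ipBl//.
  by apply: eq_ip => // x _ /=; ring.
move=> /(ip_eq0_ae mD LB) e; apply: ae_eq_nrm => //.
by apply: filterS e => x /= /[apply] /eqP; rewrite subr_eq0 => /eqP ->.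
Qed.

End vertex_patch.

(** * The estimate on a vertex patch *)
Section patch_estimate.
Context {R : realType} {l r : R} (M : mesh l r) (a : vertex M) (b : R).
Implicit Types (f g v w z : R -> R).
Local Notation mu := (@lebesgue_measure R).
Local Notation c := (omega_l a).
Local Notation d := (omega_r a).
Local Notation y := (node M a).
Local Notation D := (`]omega_l a, omega_r a[%classic).
Local Notation Om := (`]l, r[%classic).
Hypotheses (hlr : l < r) (hb : b != 0).

Let mD : measurable (D : set R). Proof. by []. Qed.
Let cd : c < d. Proof. exact: omega_lt. Qed.
Let DOm : D `<=` (Om : set R).
Proof. by apply: subset_oo; [exact: omega_l_ge|exact: omega_r_le]. Qed.

Lemma vertex_trichotomy : ~ outflow_vertex b a -> interior_vertex a \/ inflow_vertex b a.
Proof.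
move=> nout.
have ly : l <= y := le_trans (omega_l_ge a) (omega_l_node a).
have yr : y <= r := le_trans (node_omega_r a) (omega_r_le a).
have bd : (y = l \/ y = r) -> inflow_vertex b a.
  move=> e; split=> //; have : b * normal l y != 0.
    by rewrite mulf_neq0// /normal; case: ifP; rewrite ?oppr_eq0 oner_eq0.
  by rewrite oppr_gt0 neq_lt => /orP[//|h]; case: nout; split.
have [yl|yl] := eqVneq y l; first by right; apply: bd; left.
have [yr'|yr'] := eqVneq y r; first by right; apply: bd; right.
by left; rewrite /interior_vertex in_itv/= !lt_neqAle eq_sym yl ly yr' yr.
Qed.

Lemma hat_end e : e = c \/ e = d -> e = y \/ hat a e = 0.
Proof.
move=> ee; have [->|ey] := eqVneq e y; [by left|right].
by apply: hat_out => //; case: ee => ->; rewrite ltxx ?andbF.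
Qed.

Lemma outflow_omega e : outflow_vertex b a -> outflow b c d e -> e = y.
Proof.
move=> out oe; apply: (outflow_unique cd oe).
case: out => ye by0; split.
  by case: ye => ye; [left; rewrite node_eq_l|right; rewrite node_eq_r].
move: by0; rewrite /normal; case: ye => ye.
  by rewrite (node_eq_l ye) ye !eqxx.
have -> : (y == c) = false by rewrite -(node_eq_r ye) gt_eqF.
by rewrite ye (gt_eqF hlr).
Qed.

Lemma hat_outflow e : outflow b l r e -> ~ outflow_vertex b a -> hat a e = 0.
Proof.
move=> oe nout; apply: hat_out; first by apply/eqP => ey; apply: nout; rewrite /outflow_vertex -ey.
have lc := omega_l_ge a; have dr := omega_r_le a.
case: oe => -[->|->] _; first by rewrite [c < l]ltNge lc.
by rewrite [r < d]ltNge dr andbF.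
Qed.

(** A function with derivative [z] on the patch, in the space for which the
    Poincare-Friedrichs constant is available; the integration constant is
    used to reach it. It is constant outside the patch, so it is defined on
    the whole domain and [hat * v] is an admissible global test function. *)
Lemma dual_function z : L2 D z -> exists v,
  [/\ abscont l r v (z \_ D), outflow_vertex b a -> v y = 0 &
      ~ outflow_vertex b a -> ip D v (cst 1) = 0].
Proof.
move=> Lz; have Lw : L2 Om (z \_ D) by exact: L2_patch.
have [out|nout] := pselect (outflow_vertex b a).
  exists (fun x => - oint l y (z \_ D) + oint l x (z \_ D)).
  by split=> [|_|//]; [exact: abscont_primitive|rewrite addrC subrr].
pose W x := oint l x (z \_ D).
pose k := - oint c d W / (d - c).
exists (fun x => k + W x); split=> [|//|_]; first exact: abscont_primitive.
have LW : L2 D W.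
  apply: (@L2S _ Om) => //; apply: continuous_L2_oo.
  by apply: oint_continuous; [exact: ltW|exact: L2_L1_oo].
rewrite ip_oint (@eq_oint _ _ _ _ (fun x => cst k x + W x)); last first.
  by move=> x _; rewrite mulr1.
rewrite /oint L1_intD//; [|by apply: L1_cst => //; exact: mu_oo_lty|exact: L2_L1_oo].
rewrite -!/(oint _ _ _) oint_cst ?(ltW cd)// /k divfK ?addNr//.
by rewrite subr_eq0 gt_eqF.
Qed.

Section estimate.
Variables (f u uh s : R -> R) (k' k : nat) (C : R).
Hypotheses (hf : L2 Om f) (hu2 : L2 Om u).
Hypothesis hu : forall v, H1_plus b l r v ->
  - ip Om u (fun x => b * grad Om v x) = ip Om f v.
Hypothesis huhP : ppoly k (is_vertex_of a) uh.
Hypothesis huh : interior_vertex a \/ inflow_vertex b a ->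
  ip D f (hat a) + ip D uh (fun x => b * grad D (hat a) x) = 0.
Hypothesis hk : (k <= k')%N.
Hypothesis hsP : ppoly k' (is_vertex_of a) s.
Hypothesis hsH1 : H1 D s.
Hypothesis hs : forall vh, ppoly k' (is_vertex_of a) vh ->
  ip D (fun x => b * grad D (hat a \* s) x) vh =
  ip D (fun x => f x * hat a x + b * grad D (hat a) x * uh x) vh.
Hypothesis hC : is_PF_constant b a C.

Let Lf : L2 D f. Proof. exact: L2S DOm hf. Qed.
Let Lu : L2 D u. Proof. exact: L2S DOm hu2. Qed.
Let Luh : L2 D uh. Proof. exact: ppoly2_L2 ((ppoly_ppoly2 _ _ _).1 huhP). Qed.
Let Ls : L2 D s. Proof. exact: ppoly2_L2 ((ppoly_ppoly2 _ _ _).1 hsP). Qed.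
Let Lfh : L2 D (f \* hat a).
Proof.
rewrite (_ : f \* hat a = fun x => hat a x * f x); first exact: hatM_L2.
by apply/funext => x /=; rewrite mulrC.
Qed.

Let Lgh : L2 D (grad D (hat a)).
Proof. exact: grad_L2 (abscont_weak (ltW cd) (hat_abscont_omega a)). Qed.

(** The equation of [u] tested with [hat * v], which vanishes at the outflow
    point: either [v] does, or [hat] does because the vertex is not the
    outflow one. Everything outside the patch is zero. *)
Lemma test_hat v z : L2 D z -> abscont l r v (z \_ D) ->
  (outflow_vertex b a -> v y = 0) ->
  b * (ip D (fun x => dhat a x * u x) v + ip D (fun x => hat a x * u x) z) =
  - ip D (f \* hat a) v.
Proof.
move=> Lz Av vy.
have AV := abscont_mul (ltW hlr) (hat_abscont a) Av.
set V := hat a \* v in AV; set g := (fun x => _) in AV.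
have wV := abscont_weak (ltW hlr) AV.
have LV : L2 Om V := continuous_L2_oo (abscont_continuous (ltW hlr) AV).
have H1V : H1_plus b l r V.
  split; first by split=> //; exists g.
  move=> e oe; exists V; split.
  - exact: abscont_continuous (ltW hlr) AV.
  - by apply: aeW.
  - rewrite /V /=; have [out|nout] := pselect (outflow_vertex b a).
      by rewrite (outflow_unique hlr oe out) vy// mulr0.
    by rewrite (hat_outflow oe nout) mul0r.
have Lg : L2 Om g by case: AV.
have mOm : measurable (Om : set R) by [].
have Lv : L2 D v by apply: L2S DOm _ => //; exact: continuous_L2_oo (abscont_continuous (ltW hlr) Av).
have := hu H1V.
have -> : ip Om u (fun x => b * grad Om V x) = ip Om u (fun x => b * g x).
  apply: ae_eq_ip => //; [exact: L2Z (grad_L2 wV)|exact: L2Z|exact: ae_eq_refl|].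
  by apply: filterS (grad_ae hlr wV) => x /= h xO; rewrite h.
have hat0 x : Om x -> ~ D x -> hat a x = 0.
  move=> xO xD; have nD : ~~ (c < x < d) by apply/negP => h; apply: xD; rewrite /= in_itv.
  apply: hat_out => //; apply/eqP => xy; move: xO; rewrite /= in_itv/= => /andP[lx xr].
  move: nD; rewrite xy negb_and -!leNgt => /orP[yc|dy].
    have /omega_l_eq e : c = y by apply/le_anti; rewrite omega_l_node.
    by move: lx; rewrite xy e ltxx.
  have /omega_r_eq e : y = d by apply/le_anti; rewrite dy node_omega_r.
  by move: xr; rewrite xy e ltxx.
rewrite (ip_subdomain u DOm); last first.
  move=> x xO xD; rewrite /g hat0// mul0r addr0 dhat_out ?mul0r ?mulr0//.
  by apply/negP => h; apply: xD; rewrite /= in_itv.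
rewrite (ip_subdomain f DOm); last by move=> x xO xD; rewrite /V /= hat0// mul0r.
rewrite (_ : ip D f V = ip D (f \* hat a) v); last first.
  by apply: eq_oint => x _; rewrite /V /=; ring.
have Ldu := dhatM_L2 (a := a) Lu; have Lhu := hatM_L2 (a := a) Lu.
have LgD : L2 D g by exact: L2S DOm Lg.
move=> <-; rewrite opprK ipZr//; congr (_ * _).
rewrite /ip -L1_intD//; [|exact: L2_mul_L1|exact: L2_mul_L1].
by apply: eq_oint => x xD; rewrite /g patchE mem_oo xD; ring.
Qed.

(** The duality identity of the introduction is [key]; [B1], [B2] and [B3]
    bound its three terms. Only [B3] produces [1/pi]: the projection error has
    mean zero on the patch because constants are piecewise polynomials, so its
    primitive vanishes at both ends. *)
Lemma weighted_error_bound :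
  nrm D (fun x => hat a x * (uh x - s x)) <=
    (1 + C * h_omega a * nrm_oo D (grad D (hat a))) * nrm D (u \- uh) +
    h_omega a / (pi * `|b|) *
      nrm D (f \* hat a \- L2proj D (ppoly k' (is_vertex_of a)) (f \* hat a)).
Proof.
pose z x := hat a x * (uh x - s x).
have Lus : L2 D (uh \- s) by exact: L2B.
have Lz : L2 D z by exact: hatM_L2.
have [T [e [AT pe Ts ge T0]]] := hatM_derivative hsP hsH1.
have Le : L2 D e := ppoly2_L2 ((ppoly_ppoly2 _ _ _).1 pe).
have Lduh : L2 D (fun x => dhat a x * uh x) := dhatM_L2 Luh.
(* The discrete equation says that this is the projection of f * hat. *)
pose p x := b * e x - b * (dhat a x * uh x).
have Lp : L2 D p by apply: L2B => //; exact: L2Z.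
have pp : ppoly k' (is_vertex_of a) p.
  move: pe huhP => /ppoly_ppoly2[e1 e2] /ppoly_ppoly2[u1 u2]; apply/ppoly_ppoly2.
  have [d1 d2] := dhat_poly2 a.
  have P c' d' : poly_on k'.+1 c' d' e -> poly_on k.+1 c' d' uh -> poly_on 1 c' d' (dhat a) ->
      poly_on k'.+1 c' d' p.
    move=> he hu' hd.
    have : poly_on k'.+1 c' d' ((fun x => b * e x) \+ (fun x => (- b) * (dhat a \* uh) x)).
      apply: poly_onD; first exact: poly_onZ.
      by apply: poly_onZ; apply: (@poly_on_leq _ k.+1) => //; exact: poly_onM hd hu'.
    by congr poly_on; apply/funext => x; rewrite /p /=; ring.
  by split; apply: P.
have Lq q : ppoly k' (is_vertex_of a) q -> L2 D q.
  by move=> /ppoly_ppoly2 /ppoly2_L2.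
pose g := f \* hat a \- p.
have Lg : L2 D g by exact: L2B.
have orth q : ppoly k' (is_vertex_of a) q -> ip D g q = 0.
  move=> pq; have := hs pq; have Lq' := Lq _ pq.
  have LgT : L2 D (grad D (hat a \* s)).
    have := abscont_weak (ltW cd) AT; move=> /(weak_ae _ _ Ts) w; apply: grad_L2.
    apply: w; first exact: continuous_L2_oo (abscont_continuous (ltW cd) AT).
    exact: hatM_L2.
  rewrite (@ae_eq_ip _ D mD _ (fun x => b * e x) q q) //; last 4 first.
  - exact: L2Z.
  - exact: L2Z.
  - by apply: filterS ge => x /= h xD; rewrite h.
  - exact: ae_eq_refl.
  have Lr : L2 D (fun x => f x * hat a x + b * (dhat a x * uh x)).
    by apply: L2D => //; exact: L2Z.
  have gr : ae_eq mu D (fun x => f x * hat a x + b * (dhat a x * uh x))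
      (fun x => f x * hat a x + b * grad D (hat a) x * uh x).
    by apply: filterS (grad_hat a) => x /= h xD; rewrite h// mulrA.
  have mr : measurable_fun D (fun x => f x * hat a x + b * grad D (hat a) x * uh x).
    apply: measurable_funD; first exact: L2_meas Lfh.
    by apply: measurable_funM; [exact: L2_meas (L2Z b mD Lgh)|exact: L2_meas Luh].
  have Lr' := L2_ae mD mr gr Lr.
  rewrite -(@ae_eq_ip _ D mD _ _ q q Lr Lr' Lq' Lq' gr (ae_eq_refl _ _ _)) => E.
  rewrite (_ : ip D g q = ip D ((fun x => f x * hat a x + b * (dhat a x * uh x)) \-
      (fun x => b * e x)) q); last by apply: eq_oint => x _; rewrite /g /p /=; ring.
  rewrite ipBl//; last exact: L2Z.
  by rewrite E subrr.
have one : ppoly k' (is_vertex_of a) (cst 1).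
  by apply/ppoly_ppoly2; split; apply: (@poly_on_leq _ 1) => //; exact: poly_on_cst.
rewrite (nrm_L2proj Lfh pp orth) -/g -/z.
have [v [Av vy v1]] := dual_function Lz.
have Avz : abscont c d v z.
  have := abscont_sub (omega_l_ge a) (ltW cd) (omega_r_le a) Av.
  apply: abscont_ae; first exact: L2_meas Lz.
  by apply: eq_ae_eq => x /= xD; rewrite patchE mem_set.
have Lv : L2 D v := continuous_L2_oo (abscont_continuous (ltW cd) Avz).
have wv := abscont_weak (ltW cd) Avz.
(* v lies in the space of the Poincare-Friedrichs inequality. *)
have PF : nrm D v <= h_omega a * C * nrm D z.
  have <- : nrm D (grad D v) = nrm D z.
    by apply: ae_eq_nrm => //; [exact: grad_L2 wv|exact: grad_ae].
  apply: hC.2; split=> [nout|out].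
    by split; [split=> //; exists z|exact: v1].
  split; first by split=> //; exists z.
  move=> x ox; exists v; split.
  - exact: abscont_continuous (ltW cd) Avz.
  - exact: aeW.
  - by rewrite (outflow_omega out ox) vy.
(* Off the outflow vertex the balance equation of uh gives T c = T d, and hat,
   hence T, vanishes at one of the two ends; at the outflow vertex v vanishes. *)
have Tv0 x : x = c \/ x = d -> T x * v x = 0.
  move=> xe; have [out|nout] := pselect (outflow_vertex b a).
    by case: (hat_end xe) => [->|/T0 ->]; rewrite ?vy ?mulr0 ?mul0r.
  have e0 : oint c d e = 0.
    have := huh (vertex_trichotomy nout).
    have L1' : L2 D (cst 1) := Lq _ one.
    have -> : ip D uh (fun x => b * grad D (hat a) x) = ip D uh (fun x => b * dhat a x).
      apply: ae_eq_ip => //; [exact: L2Z|apply: L2Z => //|exact: ae_eq_refl|].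
        by case: (hat_abscont_omega a).
      by apply: filterS (grad_hat a) => t /= h tD; rewrite h.
    have -> : ip D f (hat a) = ip D (f \* hat a) (cst 1).
      by apply: eq_oint => t _; rewrite mulr1.
    have -> : ip D uh (fun x => b * dhat a x) = ip D (fun x => b * (dhat a x * uh x)) (cst 1).
      by apply: eq_oint => t _; rewrite mulr1; ring.
    have := orth _ one; rewrite /g ipBl// /p ipBl//; [|exact: L2Z|exact: L2Z].
    rewrite (@ipZl _ _ mD b e)// => h1 h2.
    have : b * ip D e (cst 1) = 0 by lra.
    move=> /eqP; rewrite mulf_eq0 (negbTE hb)/= => /eqP <-.
    by apply: eq_oint => t _; rewrite mulr1.
  have Tcd : T d = T c.
    by case: AT => _ /(_ d); rewrite lexx (ltW cd) e0 addr0 => /(_ isT).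
  have Tc : T c = 0.
    have [cy|/T0//] := hat_end (or_introl erefl).
    have [dy|/T0 <-//] := hat_end (or_intror erefl).
    by move: cd; rewrite cy dy ltxx.
  by case: xe => ->; rewrite ?Tcd Tc mul0r.
have byparts : ip D e v + ip D (fun x => hat a x * s x) z = 0.
  have := abscont_by_parts (ltW cd) AT Avz.
  rewrite !Tv0 ?subrr; [|by left|by right].
  rewrite -!ip_oint (@ae_eq_ip _ D mD T (fun x => hat a x * s x) z z)//.
  - exact: continuous_L2_oo (abscont_continuous (ltW cd) AT).
  - exact: hatM_L2.
  - exact: ae_eq_refl.
have test := test_hat Lz Av vy.
have Lhu := hatM_L2 (a := a) Lu; have Lhuh := hatM_L2 (a := a) Luh.
have Lhs := hatM_L2 (a := a) Ls; have Ldu := dhatM_L2 (a := a) Lu.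
have key : b * nrm D z ^+ 2 =
    b * ip D (fun x => hat a x * (uh x - u x)) z +
    b * ip D (fun x => dhat a x * (uh x - u x)) v - ip D g v.
  rewrite nrm_sqr.
  have -> : ip D z z = ip D (fun x => hat a x * uh x) z - ip D (fun x => hat a x * s x) z.
    by rewrite -ipBl//; apply: eq_oint => x _; rewrite /z /=; ring.
  have -> : ip D (fun x => hat a x * (uh x - u x)) z =
      ip D (fun x => hat a x * uh x) z - ip D (fun x => hat a x * u x) z.
    by rewrite -ipBl//; apply: eq_oint => x _; rewrite /z /=; ring.
  have -> : ip D (fun x => dhat a x * (uh x - u x)) v =
      ip D (fun x => dhat a x * uh x) v - ip D (fun x => dhat a x * u x) v.
    by rewrite -ipBl//; apply: eq_oint => x _ /=; ring.
  rewrite /g ipBl// /p ipBl//; [|exact: L2Z|exact: L2Z].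
  rewrite (@ipZl _ _ mD b e)// (@ipZl _ _ mD b (fun x => dhat a x * uh x))//.
  by move: test byparts => /eqP; rewrite -addr_eq0 => /eqP t1 t2; nra.
have Lud : L2 D (u \- uh) by exact: L2B.
have Lhud : L2 D (fun x => hat a x * (uh x - u x)) by apply: hatM_L2; exact: L2B.
have Ldud : L2 D (fun x => dhat a x * (uh x - u x)) by apply: dhatM_L2; exact: L2B.
have B1 : `|ip D (fun x => hat a x * (uh x - u x)) z| <= nrm D (u \- uh) * nrm D z.
  apply: (le_trans (cauchy_schwarz mD Lhud Lz)); rewrite ler_wpM2r ?nrm_ge0//.
  apply: le_nrm => // x _ /=; have /andP[h0 h1] := hat_ge0_le1 a x.
  by rewrite normrM (ger0_norm h0) distrC ler_piMl.
have N0 := nrm_oo_ge0 a.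
have B2 : `|ip D (fun x => dhat a x * (uh x - u x)) v| <=
    nrm_oo D (grad D (hat a)) * nrm D (u \- uh) * (h_omega a * C * nrm D z).
  apply: (le_trans (cauchy_schwarz mD Ldud Lv)).
  apply: ler_pM; rewrite ?nrm_ge0//.
  apply: le_nrm_ae => //.
  refine (ae_imp _ (dhat_le_nrm_oo a)) => x /= + xD => /(_ xD) h.
  by rewrite normrM distrC ler_wpM2r.
have B3 : `|ip D g v| <= h_omega a / pi * nrm D g * nrm D z.
  have AG := abscont_primitive 0 Lg; set G := (fun x => _) in AG.
  have Gc : G c = 0 by rewrite /G oint_nil addr0.
  have Gd : G d = 0.
    rewrite /G add0r -(orth _ one); apply: eq_oint => x _; by rewrite mulr1.
  have := abscont_by_parts (ltW cd) AG Avz; rewrite Gc Gd !mul0r subrr -!ip_oint => /eqP.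
  rewrite addr_eq0 => /eqP ->; rewrite normrN.
  have LG := continuous_L2_oo (abscont_continuous (ltW cd) AG).
  apply: (le_trans (cauchy_schwarz mD LG Lz)); rewrite ler_wpM2r ?nrm_ge0//.
  exact: friedrichs_sharp.
apply: absorb_norm; rewrite ?nrm_ge0 ?normr_gt0 ?pi_gt0//.
- by rewrite subr_ge0 ltW.
- by apply: ltW; case: hC.
- rewrite -[X in _ * X](ger0_norm (sqr_ge0 _)) -normrM key.
  apply: (le_trans (ler_normB _ _)); apply: lerD => //.
  apply: (le_trans (ler_normD _ _)); rewrite !normrM; apply: lerD; rewrite ler_wpM2l//.
Qed.

End estimate.
End patch_estimate.

(** * The estimate on an element *)

Theorem theorem7p1 (R : realType) (l r b : R) (hlr : l < r) (hb : b != 0)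
    (f : R -> R) (hf : L2 `]l, r[ f)
    (Th : mesh l r)
    (u : R -> R) (huL2 : L2 `]l, r[ u)
    (hu : forall v, H1_plus b l r v ->
      - ip `]l, r[ u (fun x => b * grad `]l, r[ v x) = ip `]l, r[ f v)
    (k : nat) (uh : R -> R) (huhP : ppoly k (xpredT : pred (element Th)) uh)
    (huh : forall a : vertex Th, interior_vertex a \/ inflow_vertex b a ->
      ip (omega a) f (hat a) +
      ip (omega a) uh (fun x => b * grad (omega a) (hat a) x) = 0)
    (k' : nat) (hk : (k <= k')%N)
    (s : vertex Th -> R -> R)
    (hsP : forall a, ppoly k' (is_vertex_of a) (s a))
    (hsH1 : forall a, H1 (omega a) (s a))
    (hs : forall a vh, ppoly k' (is_vertex_of a) vh ->
      ip (omega a) (fun x => b * grad (omega a) (hat a \* s a) x) vh =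
      ip (omega a)
        (fun x => f x * hat a x + b * grad (omega a) (hat a) x * uh x) vh)
    (C_PF : vertex Th -> R) (hC : forall a, is_PF_constant b a (C_PF a)) :
  let sh := fun x => \sum_(a : vertex Th) hat a x * s a x in
  let eta_NC := fun K : element Th => nrm (cell K) (uh \- sh) in
  forall K : element Th,
    eta_NC K <=
      C_cont_PF C_PF *
        (\sum_(a : vertex Th | is_vertex_of a K) nrm (omega a) (u \- uh)) +
      \sum_(a : vertex Th | is_vertex_of a K)
        h_omega a / (pi * `|b|) *
        nrm (omega a)
          (f \* hat a \- L2proj (omega a) (ppoly k' (is_vertex_of a)) (f \* hat a)).
Proof.
move=> sh eta_NC K.
have uhP (a : vertex Th) : ppoly k (is_vertex_of a) uh.
  by move=> K' _; exact: (huhP K' isT).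
pose z (a : vertex Th) x := hat a x * (uh x - s a x).
have Lz a : L2 (omega a) (z a).
  apply: hatM_L2; apply: L2B => //.
    exact: ppoly2_L2 ((ppoly_ppoly2 _ _ _).1 (uhP a)).
  exact: ppoly2_L2 ((ppoly_ppoly2 _ _ _).1 (hsP a)).
have vK (a : vertex Th) : a = vleft K \/ a = vright K -> is_vertex_of a K.
  by rewrite /is_vertex_of => -[->|->]; rewrite ?vleftE ?vrightE eqxx ?orbT.
have mK : measurable (cell K) by exact: measurable_itv.
have zK (a : vertex Th) : is_vertex_of a K -> L2 (cell K) (z a) /\ nrm (cell K) (z a) <= nrm (omega a) (z a).
  move=> aK; have sub := cell_omega aK; split; first by apply: L2S (Lz a) => //; exact: measurable_itv.
  by apply: nrmS => //; exact: measurable_itv.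
have shE x : cell K x -> sh x = hat (vleft K) x * s (vleft K) x + hat (vright K) x * s (vright K) x.
  move=> xK; rewrite /sh (bigID (fun a => is_vertex_of a K))/= sum_vertices.
  by rewrite big1 ?addr0// => a aK; rewrite (hat_cell_out xK aK) mul0r.
(* The two hat functions of the endpoints of K sum to 1 on K. *)
have split_error : nrm (cell K) (uh \- sh) = nrm (cell K) (z (vleft K) \+ z (vright K)).
  rewrite /nrm; congr Num.sqrt; apply: eq_ip => x; rewrite inE => xK /=;
    by rewrite shE// /z -[uh x in LHS]mul1r -(hat_partition xK); ring.
have [Ll nl] := zK _ (vK _ (or_introl erefl)).
have [Lr nr] := zK _ (vK _ (or_intror erefl)).
have bound (a : vertex Th) : nrm (omega a) (z a) <= C_cont_PF C_PF * nrm (omega a) (u \- uh) +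
    h_omega a / (pi * `|b|) *
    nrm (omega a)
      (f \* hat a \- L2proj (omega a) (ppoly k' (is_vertex_of a)) (f \* hat a)).
  apply: (le_trans (weighted_error_bound hlr hb hf huL2 hu (uhP a) (huh a) hk
    (hsP a) (hsH1 a) (hs a) (hC a))).
  rewrite lerD2r ler_wpM2r ?nrm_ge0//.
  exact: (le_bigmax 0 (fun a => 1 + C_PF a * h_omega a * nrm_oo (omega a) (grad (omega a) (hat a)))).
rewrite /eta_NC split_error !sum_vertices mulrDr addrACA.
apply: (le_trans (nrmD mK Ll Lr)); apply: lerD.
  exact: le_trans nl (bound _).
exact: le_trans nr (bound _).
Qed.
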